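(* Assume that $\delta_{n,\mathcal N}\ge 1$ for every $n\in\mathcal N$. Let $h\in H$ and let $a$ be a reduced lift of $h$. Below, $k=\sum_{n\in\widehat{\mathcal N}}k_nE_n^*$ with $k_n\in\mathbb Z$ (and $k_n:=0$ for $n\in\mathcal N\setminus\widehat{\mathcal N}$); for $i\in\{1,2\}$, ''$0\le k\le\delta-i$'' means $0\le k_n\le\delta_{n,\mathcal N}-i$ for all $n\in\widehat{\mathcal N}$, and $(-1)^k\binom{\delta-i}{k}:=\prod_{n\in\widehat{\mathcal N}}(-1)^{k_n}\binom{\delta_{n,\mathcal N}-i}{k_n}$. Rational functions are identified with their Taylor expansions at the origin. (a) Let $\{\mathfrak v_n\}_{n\in\mathcal N}$ be a set of vectors which is admissible for $(a-k,\kappa=0)$ for every $0\le k\le\delta-1$ (so that $N_a(\ell+\mathfrak v_n,n)\ge k_n$ for all $n\in\mathcal N$ and $\ell\in\overline{\mathcal M}_{a-k}$). Then $$Z_h(\mathbf t_{\mathcal N})=\sum_{0\le k\le\delta-1}(-1)^k\binom{\delta-1}{k}\sum_{\emptyset\subseteq\mathcal I\subseteq\mathcal N}(-1)^{|\mathcal I|}\,\frac{\sum_{\ell\in\mathcal M^-_{a-k,\mathcal I}}\mathbf t^{\mathbf c_a+\ell}}{\prod_{n\in\mathcal N\setminus\mathcal I}(1-\mathbf t^{\mathfrak v_n})}.$$ (b) Let $\{\mathfrak v_n\}_{n\in\mathcal N}$ be a set of vectors which is admissible for $(a-k,\kappa=1)$ for every $0\le k\le\delta-2$ (so that $N_a(\ell+\mathfrak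 v_n,n)\ge k_n+1$ for all $n\in\mathcal N$ and $\ell\in\overline{\mathcal M}_{a-k}$). Then $$Z_h(\mathbf t_{\mathcal N})=\sum_{0\le k\le\delta-2}(-1)^k\binom{\delta-2}{k}\sum_{\widehat{\mathcal N}\subseteq\mathcal I\subseteq\mathcal N}(-1)^{|\mathcal I\setminus\widehat{\mathcal N}|}\,\frac{\sum_{\ell\in\mathrm{gr}_k\mathcal M^-_{a,\mathcal I}}\mathbf t^{\mathbf c_a+\ell}}{\prod_{n\in\mathcal N\setminus\mathcal I}(1-\mathbf t^{\mathfrak v_n})}.$$
   Context: **Graph and lattices.** $\Gamma$ is a connected negative definite plumbing tree with vertex set $\mathcal V$, all genera $0$, integer decorations $b_v$, which is the dual graph of the minimal good resolution of a normal surface singularity (so $b_v\le -2$ whenever the valency $\delta_v\le 2$); $M$ is its plumbed 3-manifold (a rational homology sphere). $L=\bigoplus_{v\in\mathcal V}\mathbb Z E_v$ has the negative definite form $(E_v,E_v)=b_v$, $(E_v,E_w)=1$ if $v\neq w$ are adjacent, $0$ otherwise. $L'=\{l'\in L\otimes\mathbb Q:(l',L)\subset\mathbb Z\}\supset L$ is freely generated by $E_v^*$, where $(E_v^*,E_w)=-1$ if $v=w$ and $0$ otherwise. $H=L'/L\simeq H_1(M,\mathbb Z)$, $[l']$ is the class of $l'$. **Nodes and Seifert invariants.** $\mathcal N=\{n:\delta_n\ge 3\}$ is the set of nodes (assumed nonempty), $\mathcal E=\{u:\delta_u=1\}$ the set of ends. For $n\in\mathcal N$, $\mathcal N_n$ is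 the set of nodes $n'\ne n$ such that the path from $n$ to $n'$ has no node in its interior $(n,n')$ (neighbouring nodes); $\mathcal E_n$ is the set of ends $u$ such that the path $(n,u]$ ($n$ excluded) contains no node. $\delta_{n,\mathcal N}=|\mathcal N_n|$, $\widehat{\mathcal N}=\{n\in\mathcal N:\delta_{n,\mathcal N}\ge 2\}$. For a full subgraph, $\det$ denotes the determinant of the negative of its intersection matrix ($1$ for the empty graph). For $u\in\mathcal E_n$: $\alpha_u=\det_{(n,u]}$ and $\omega_u$ is the determinant of $(n,u]$ with the vertex adjacent to $n$ deleted. For $n'\in\mathcal N_n$: $\alpha_{n,n'}=\alpha_{n',n}=\det_{(n,n')}$ and $\omega_{n,n'}$ is the determinant of $(n,n')$ with the vertex adjacent to $n$ deleted; if $(n,n')=\emptyset$ put $\alpha_{n,n'}=1$, $\omega_{n,n'}=0$. **Reduced lifts.** For each pair of neighbouring nodes fix an order $n<n'$ or $n'<n$; sums over $n'>n$ or $n'<n$ run over neighbouring nodes $n'\in\mathcal N_n$, and ''$n<n'$'' always refers to neighbouring nodes. For $n<n'$, $n_{n'}$ is the vertex adjacent to $n$ on the path from $n$ to $n'$ ($n_{n'}=n'$ if $(n,n')=\emptyset$). A reduced lift of $h\in H$ is an element $a=\sum_{n\in\mathcal N}a_nE_n^*+\sum_{u\in\mathcal E}a_uE_u^*+\sum_{n<n'}a_{n_{n'}}E^*_{n_{n'}}\in L'$, given with its integer coefficients (coefficient $a_{n_{n'}}$ is kept separate from $a_{n'}$ if $(n,n')=\emptyset$), such that $[a]=h$.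 For $k=\sum_{n\in\mathcal N} k_nE_n^*$, $a-k$ is the reduced lift with $a_n$ replaced by $a_n-k_n$. $\pi_{\mathcal N}:\mathbb R\langle E_v\rangle_{v\in\mathcal V}\to\mathbb R\langle E_n\rangle_{n\in\mathcal N}$ is the coordinate projection and $\mathbf c_a:=\pi_{\mathcal N}(a)$. **Poincaré series.** $\mathbf t^{l'}=\prod_v t_v^{l_v}$ for $l'=\sum_v l_vE_v$. Let $Z_H(\mathbf t)=\sum_{l'}p_{l'}[l']\mathbf t^{l'}$ be the Taylor expansion at the origin of $f_H(\mathbf t)=\prod_{v\in\mathcal V}(1-[E_v^*]\mathbf t^{E_v^*})^{\delta_v-2}$ (coefficients in $\mathbb Z[H]$), $Z_h(\mathbf t)=\sum_{[l']=h}p_{l'}\mathbf t^{l'}$, and $Z_h(\mathbf t_{\mathcal N})=Z_h(\mathbf t)|_{t_v=1,\,v\notin\mathcal N}$. **Sets attached to a reduced lift $a$.** $\mathbb Z^{\mathcal N}(a)=\{\ell=\sum_{n\in\mathcal N}\ell_nE_n:\ \ell_n\in\mathbb Z,\ \ell_n+\omega_{n',n}\ell_{n'}\equiv a_{n_{n'}}\ (\mathrm{mod}\ \alpha_{n,n'})\ \forall\, n<n'\}$. For $n\in\mathcal N$, $$N_a(\ell,n)=a_n+\sum_{n'>n}\frac{\omega_{n,n'}}{\alpha_{n,n'}}a_{n_{n'}}+\sum_{n'<n}\frac{1}{\alpha_{n,n'}}a_{n'_n}-\Big(b_n+\sum_{n'\in\mathcal N_n}\frac{\omega_{n,n'}}{\alpha_{n,n'}}\Big)\ell_n-\sum_{n'\in\mathcal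 N_n}\frac{\ell_{n'}}{\alpha_{n,n'}}+\sum_{u\in\mathcal E_n}\Big\lfloor\frac{a_u-\omega_u\ell_n}{\alpha_u}\Big\rfloor,$$ $\overline N_a(\ell,n)=N_a(\ell,n)+\sum_{u\in\mathcal E_n}\{(a_u-\omega_u\ell_n)/\alpha_u\}$ ($\{\cdot\}$ is the fractional part). $\mathcal M_a=\{\ell\in\mathbb Z^{\mathcal N}(a):N_a(\ell,n)\ge 0\ \forall n\in\mathcal N\}$, $\overline{\mathcal M}_a=\{\ell\in\mathbb Z^{\mathcal N}(a):\overline N_a(\ell,n)\ge 0\ \forall n\in\mathcal N\}$. $\mathcal C^{orb}=\pi_{\mathcal N}(\mathcal S'_{\mathbb R})$, where $\mathcal S'_{\mathbb R}=\{l\in L\otimes\mathbb R:(l,E_v)\le 0\ \forall v\in\mathcal V\}$. **Admissible vectors.** A family $\{\mathfrak v_n\}_{n\in\mathcal N}\subset\mathcal M_0$ is called admissible for $(a,\kappa)$, with $a$ a reduced lift and $\kappa\ge 0$, if $\mathbb R_{\ge0}\langle\mathfrak v_n\rangle_{n\in\mathcal N}=\mathcal C^{orb}$ and for all $\ell\in\overline{\mathcal M}_a$, $n\in\mathcal N$: $N_a(\ell+\mathfrak v_n,n')=N_a(\ell,n')$ for all nodes $n'\ne n$, and $N_a(\ell+\mathfrak v_n,n)\ge\kappa$. Given such vectors, $\Box=\sum_{n\in\mathcal N}[0,1)\mathfrak v_n$. **Holes.** For $\mathcal I\subseteq\mathcal N$ and a reduced lift $b$, $\mathcal M^-_{b,\mathcal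 I}=\{\ell\in(\Box-\mathbf c_b)\cap\mathbb Z^{\mathcal N}(b):N_b(\ell,n)<0\ \forall n\in\mathcal I\}$. For $\widehat{\mathcal N}\subseteq\mathcal I\subseteq\mathcal N$, $$\mathrm{gr}_k\mathcal M^-_{a,\mathcal I}=\{\ell\in(\Box-\mathbf c_{a-k})\cap\mathbb Z^{\mathcal N}(a):\ N_a(\ell,n)<0\ \forall n\in\mathcal I\setminus\widehat{\mathcal N},\ N_a(\ell,n)=k_n\ \forall n\in\widehat{\mathcal N}\}.$$ *)

(* Defs.v *)
From HB Require Import structures.
From mathcomp Require Import all_boot all_order all_algebra.
From mathcomp Require Import all_classical all_reals.

Set Implicit Arguments.
Unset Strict Implicit.
Unset Printing Implicit Defensive.
Import Order.TTheory GRing.Theory Num.Theory.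

Local Open Scope ring_scope.

(** * Plumbing trees *)

Record plumbing_graph := PlumbingGraph {
  vertex :> finType;
  adj : rel vertex;
  decoration : vertex -> int }.

Section Graph.
Variable G : plumbing_graph.
Implicit Types (u v w : G) (A : {set G}).

Definition valency v : nat := #|[set w | adj v w]|.

Definition is_tree : Prop :=
  [/\ symmetric (@adj G), irreflexive (@adj G),
      forall u v, connect (@adj G) u v &
      forall c : seq G, ucycle (@adj G) c -> (size c <= 2)%N].

Definition inter v w : int :=
  if v == w then decoration v else (adj v w : nat)%:Z.

(* For F = int, rat, R this is the intersection form on L, L (x) Q, L (x) R;
   the coordinates are taken in the basis (E_v). *)
Definition form (F : nzRingType) (x y : {ffun G -> F}) : F :=
  \sum_v \sum_w x v * (inter v w)%:~R * y w.

Definition basisE (F : nzRingType) v : {ffun G -> F} :=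
  [ffun w => (w == v)%:R].

Definition negative_definite : Prop :=
  forall l : {ffun G -> int}, l != 0 -> form l l < 0.

(* All genera being zero, a negative definite tree is the dual graph of a good
   resolution of a normal surface singularity; the resolution is the minimal
   good one iff no (-1)-vertex has valency at most 2. *)
Definition minimal_good : Prop :=
  forall v, (valency v <= 2)%N -> decoration v <= -2.

Definition nodes : {set G} := [set v | (3 <= valency v)%N].
Definition ends : {set G} := [set u | valency u == 1%N].
Definition node : finType := {v : G | v \in nodes}.

(* The vertices of the path from u to v, in order, with u omitted. *)
Definition tpath u v : seq G :=
  xget [::] [set p | [/\ path (@adj G) u p, last u p = v & uniq (u :: p)]]%classic.

Definition step u v : G := head v (tpath u v).
Definition path_oc u v : {set G} := [set w in tpath u v].
Definition path_oo u v : {set G} := path_oc u v :\ v.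

Definition gdet A : int :=
  \det (\matrix_(i < #|A|, j < #|A|) - inter (enum_val i) (enum_val j)).

(** * The lattices L and L', and H = L'/L *)

Definition dual_lattice : set {ffun G -> rat} :=
  [set l | forall v, form l (basisE rat v) \is a Num.int]%classic.

Definition Estar v : {ffun G -> rat} :=
  xget 0 [set x | forall w, form x (basisE rat w) = if v == w then -1 else 0]%classic.

End Graph.

Arguments dual_lattice G : clear implicits.

Definition int_lattice (V : finType) : {pred {ffun V -> rat}} :=
  [pred l : {ffun V -> rat} | [forall v, l v \is a Num.int]].
Arguments int_lattice V : clear implicits.

Fact int_lattice_zmod_closed (V : finType) : zmod_closed (int_lattice V).
Proof.
split; first by rewrite inE; apply/forallP => v; rewrite ffunE rpred0.
move=> x y; rewrite !inE => /forallP hx /forallP hy.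
by apply/forallP => v; rewrite !ffunE rpredB.
Qed.

HB.instance Definition _ (V : finType) :=
  GRing.isZmodClosed.Build {ffun V -> rat} (int_lattice V)
    (int_lattice_zmod_closed V).

(* (L (x) Q) / L, which contains H = L'/L as a subgroup. *)
Definition lat_quot (V : finType) : zmodType :=
  Quotient.quot (int_lattice V : zmodClosed {ffun V -> rat}).

Definition lat_class (V : finType) (l : {ffun V -> rat}) : lat_quot V :=
  (\pi_(lat_quot V) l)%qT.

Definition Hgroup (G : plumbing_graph) : set (lat_quot G) :=
  [set lat_class l | l in dual_lattice G]%classic.
Arguments Hgroup G : clear implicits.

(** * Taylor expansions *)

(* The coefficient of X^x in (1 - X)^d, where Negz n is -(n+1). *)
Definition binom_coef (d : int) (x : nat) : int :=
  match d with
  | Posz n => (-1) ^+ x * 'C(n, x)%:Z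
  | Negz n => 'C(n + x, x)%:Z
  end.

(* The coefficient of X^e in the Taylor expansion at the origin of
   prod_i (1 - X^(g i))^(d i), i.e. in the product of the series
   sum_x binom_coef (d i) x * X^(x g i), for monomials X^g indexed by an
   additive group.  A sum over a classical set is 0 by convention if its support
   is infinite; in every use below the support is finite (the coordinates of
   each E_v^* are positive, and the denominator vectors form a basis). *)
Definition taylor (I : finType) (E : zmodType) (g : I -> E) (d : I -> int)
    (e : E) : int :=
  \sum_(x \in [set x : {ffun I -> nat} | \sum_i g i *+ x i = e]%classic)
    \prod_i binom_coef (d i) (x i).

(* The coefficient of t^c in the Taylor expansion of
   (sum_(l in S) t^(p + l)) / prod_(i in J) (1 - t^(v i)). *)
Definition taylor_frac (I : finType) (S : set {ffun I -> int})
    (p : {ffun I -> rat}) (J : {set I}) (v : I -> {ffun I -> int})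
    (c : {ffun I -> rat}) : int :=
  let toQ (l : {ffun I -> int}) : {ffun I -> rat} := [ffun i => (l i)%:~R] in
  \sum_(l \in S)
    taylor (fun i => toQ (v i)) (fun i => if i \in J then -1 else 0)
      (c - (p + toQ l)).

(** * The topological Poincare series *)

Section Poincare.
Variable G : plumbing_graph.

(* [h] t^l is the monomial with exponent (h, l). *)
Definition ZH : lat_quot G * {ffun G -> rat} -> int :=
  taylor (fun v : G => (lat_class (Estar v), Estar v))
         (fun v : G => (valency v)%:Z - 2).

Definition Zh (h : lat_quot G) (l : {ffun G -> rat}) : int := ZH (h, l).

Definition piN (F : Type) (x : {ffun G -> F}) : {ffun node G -> F} :=
  [ffun n : node G => x (val n)].

Definition Zh_nodes (h : lat_quot G) (c : {ffun node G -> rat}) : int :=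
  \sum_(l \in [set l : {ffun G -> rat} | piN l = c]%classic) Zh h l.

End Poincare.

(** * Seifert invariants and reduced lifts *)

Section Nodes.
Variable G : plumbing_graph.
Implicit Types (n m : node G) (u : G).

Definition nbr_nodes n : {set node G} :=
  [set m | (m != n) && [disjoint path_oo (val n) (val m) & nodes G]].
Definition nbr_ends n : {set G} :=
  [set u in ends G | [disjoint path_oc (val n) u & nodes G]].

Definition deltaN n : nat := #|nbr_nodes n|.
Definition hatN : {set node G} := [set n | (2 <= deltaN n)%N].

Definition alpha_end n u : int := gdet (path_oc (val n) u).
Definition omega_end n u : int :=
  gdet (path_oc (val n) u :\ step (val n) u).
Definition alpha n m : int := gdet (path_oo (val n) (val m)).
Definition omega n m : int :=
  if path_oo (val n) (val m) == finset.set0 then 0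
  else gdet (path_oo (val n) (val m) :\ step (val n) (val m)).

Definition orders_nbr_nodes (lt : rel (node G)) : Prop :=
  forall n m, m \in nbr_nodes n -> lt n m = ~~ lt m n.

(* The coefficients of a reduced lift.  Only the values of lift_end at ends and
   of lift_edge at pairs of neighbouring nodes n < m matter; lift_edge n m is
   the coefficient a_{n_m}. *)
Record reduced_lift := ReducedLift {
  lift_node : node G -> int;
  lift_end : G -> int;
  lift_edge : node G -> node G -> int }.

Definition lift0 : reduced_lift :=
  ReducedLift (fun _ => 0) (fun _ => 0) (fun _ _ => 0).

Definition lift_sub (a : reduced_lift) (k : {ffun node G -> nat}) :=
  ReducedLift (fun n => lift_node a n - (k n)%:Z) (lift_end a) (lift_edge a).

Variable lt : rel (node G).

Definition lift_elt (a : reduced_lift) : {ffun G -> rat} :=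
  \sum_n Estar (val n) *~ lift_node a n
  + \sum_(u in ends G) Estar u *~ lift_end a u
  + \sum_n \sum_(m in nbr_nodes n | lt n m)
      Estar (step (val n) (val m)) *~ lift_edge a n m.

Definition cvec (a : reduced_lift) : {ffun node G -> rat} := piN (lift_elt a).

Definition ZN (a : reduced_lift) : set {ffun node G -> int} :=
  [set l : {ffun node G -> int} |
    forall n m, m \in nbr_nodes n -> lt n m ->
      (l n + omega m n * l m = lift_edge a n m %[mod alpha n m])%Z]%classic.

Definition end_arg (a : reduced_lift) (l : {ffun node G -> int}) n u : rat :=
  (lift_end a u - omega_end n u * l n)%:~R / (alpha_end n u)%:~R.

Definition Na (a : reduced_lift) (l : {ffun node G -> int}) n : rat :=
  (lift_node a n)%:~R
  + \sum_(m in nbr_nodes n | lt n m)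
      (omega n m)%:~R / (alpha n m)%:~R * (lift_edge a n m)%:~R
  + \sum_(m in nbr_nodes n | lt m n)
      1 / (alpha n m)%:~R * (lift_edge a m n)%:~R
  - ((decoration (val n))%:~R
      + \sum_(m in nbr_nodes n) (omega n m)%:~R / (alpha n m)%:~R) * (l n)%:~R
  - \sum_(m in nbr_nodes n) (l m)%:~R / (alpha n m)%:~R
  + \sum_(u in nbr_ends n) (Num.floor (end_arg a l n u))%:~R.

Definition Nbar (a : reduced_lift) (l : {ffun node G -> int}) n : rat :=
  Na a l n
  + \sum_(u in nbr_ends n)
      (end_arg a l n u - (Num.floor (end_arg a l n u))%:~R).

Definition Mset (a : reduced_lift) : set {ffun node G -> int} :=
  [set l | ZN a l /\ forall n, 0 <= Na a l n]%classic.
Definition Mbar (a : reduced_lift) : set {ffun node G -> int} :=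
  [set l | ZN a l /\ forall n, 0 <= Nbar a l n]%classic.

Variable R : realType.

Definition lipman_cone : set {ffun G -> R} :=
  [set l | forall v, form l (basisE R v) <= 0]%classic.
Definition Corb : set {ffun node G -> R} :=
  [set piN l | l in lipman_cone]%classic.

Section Vectors.
Variable v : node G -> {ffun node G -> int}.

Definition lincomb (s : node G -> R) : {ffun node G -> R} :=
  [ffun m => \sum_n s n * (v n m)%:~R].
Definition cone : set {ffun node G -> R} :=
  [set x | exists2 s : node G -> R, forall n, 0 <= s n & x = lincomb s]%classic.
Definition box : set {ffun node G -> R} :=
  [set x | exists2 s : node G -> R, forall n, 0 <= s n < 1 & x = lincomb s]%classic.

Definition admissible (a : reduced_lift) (kappa : nat) : Prop :=
  [/\ forall n, Mset lift0 (v n),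
      cone = Corb &
      forall l, Mbar a l -> forall n,
        (forall m, m != n -> Na a (l + v n) m = Na a l m) /\
        kappa%:R <= Na a (l + v n) n].

Definition shifted_box (b : reduced_lift) : set {ffun node G -> int} :=
  [set l : {ffun node G -> int} |
    box [ffun n => (l n)%:~R + ratr (cvec b n)]]%classic.

Definition Mminus (b : reduced_lift) (I : {set node G}) :
    set {ffun node G -> int} :=
  [set l | [/\ shifted_box b l, ZN b l &
              forall n, n \in I -> Na b l n < 0]]%classic.

Definition grMminus (a : reduced_lift) (k : {ffun node G -> nat})
    (I : {set node G}) : set {ffun node G -> int} :=
  [set l | [/\ shifted_box (lift_sub a k) l, ZN a l,
              forall n, n \in I :\: hatN -> Na a l n < 0 &
              forall n, n \in hatN -> Na a l n = (k n)%:R]]%classic.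

End Vectors.

(* 0 <= k <= delta - i, for i = 1, 2. *)
Definition krange (i : nat) : set {ffun node G -> nat} :=
  [set k : {ffun node G -> nat} | forall n,
    if n \in hatN then (k n <= deltaN n - i)%N else k n == 0%N]%classic.

Definition kcoef (i : nat) (k : {ffun node G -> nat}) : int :=
  \prod_(n in hatN) ((-1) ^+ k n * 'C(deltaN n - i, k n)%:Z).

End Nodes.

Arguments hatN G : clear implicits.
Arguments krange G i : clear implicits.

(* Main.v *)
From HB Require Import structures.
Require Import Defs.
From mathcomp Require Import all_boot all_order all_algebra perm.
From mathcomp Require Import all_classical all_reals.
From mathcomp Require Import zify ring lra.

Set Implicit Arguments.
Unset Strict Implicit.
Unset Printing Implicit Defensive.
Import Order.TTheory GRing.Theory Num.Theory.
Local Open Scope ring_scope.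

(** Write d_v(z) = -(z, E_v) for a vector z, so that E_v^* is the vector with
    d_w(E_v^* ) = 1 if w = v and 0 otherwise, and z = sum_v d_v(z) E_v^*.  By the
    form of f_H, the coefficient of t^z in Z_h is the product over v of the
    coefficient of X^(d_v(z)) in (1 - X)^(delta_v - 2), provided that [z] = h and
    that all d_v(z) are nonnegative integers.  In particular z contributes only if
    d_v(z) = 0 at all vertices of valency 2.

    Fix a reduced lift a of h and integers l_n at the nodes; the question is which
    z with coordinates c_a + l at the nodes contribute.  Between two nodes, and from
    a node to an end, the equations d_v(z) = 0 are a linear recurrence along a chain
    of valency 2 vertices.  Its solutions are expressed by continuants, which are
    the determinants alpha and omega (recur_cont, edge_eq, leg_eq).  Eliminating the
    chains gives two facts.
    - z - a is integral on the chain between two nodes iff the congruence defining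
      Z^N(a) holds there; on the leg of an end u this leaves one free integer y_u,
      and d_u(z) >= 0 means y_u >= 0 (integral_ZN, integral_all, source_vec_surj).
    - At a node, d_n(z) = N_a(l, n) - sum_(u in E_n) y_u (node_defect).
    Summing over the y_u multiplies (1 - X)^(delta_n - 2) by one factor 1 / (1 - X)
    for each end of n, whence (Zh_nodes_ZN)
      coefficient of t^(c_a + l) in Z_h(t_N)
        = prod_n coefficient of X^(N_a(l, n)) in (1 - X)^(delta_(n,N) - 2)
    for l in Z^N(a), and all other coefficients vanish (Zh_nodes_neq0).

    The same elimination identifies the orbifold cone with the points where the
    linear part of all the N-bar is nonnegative (NbarE, CorbP).  Since this cone is
    spanned by the v_n, they form a basis; hence every l is l0 + sum_n m_n v_n with
    l0 in the half-open box translated by -c_a and integers m_n, in a unique way, and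
    all m_n are nonnegative iff all N-bar(l, n) are (box_decomposition).  For
    admissible vectors N_a(l, n) = N_a(l0, n) when m_n = 0, and N_a(l, n) >= kappa
    when m_n > 0.  So, given that all m_n >= 0, the node n violates N_a(l, n) >= 0 iff
    m_n = 0 and N_a(l0, n) < 0.  Inclusion-exclusion over the set I of violating nodes
    yields the generating function of the l with N_a(l, n) >= 0 for all n; with
    kappa = 1 one can also impose N_a(l, n) = 0 on some nodes, as this forces
    m_n = 0 there (holes_series).

    Finally, on the nodes with at least two neighbouring nodes, (a) comes from
    (1 - X)^(delta - 2) = (1 - X)^(delta - 1) / (1 - X), and (b) from the expansion of
    (1 - X)^(delta - 2) itself; on the remaining nodes (1 - X)^(-1) imposes
    N_a(l, n) >= 0. *)

(** * Paths in a tree *)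

Section Tree.
Variable G : plumbing_graph.
Hypothesis G_tree : is_tree G.
Implicit Types (u v w x y t : G) (p q : seq G).
Local Notation e := (@adj G).

Lemma adjC u v : e u v = e v u.
Proof. by case: G_tree => + _ _ _; apply. Qed.

Lemma adjxx u : e u u = false.
Proof. by case: G_tree => _ + _ _; apply. Qed.

Definition upath x p := path e x p && uniq (x :: p).

Lemma upath_cons x y p :
  upath x (y :: p) = [&& e x y, x \notin y :: p & upath y p].
Proof.
rewrite /upath /=; case: (e x y) => //=.
by case: (path e y p) => //=; rewrite andbF.
Qed.

Lemma path_rev x p : path e x p -> path e (last x p) (rev (belast x p)).
Proof. by rewrite rev_path (eq_path (e' := e)) // => a b; rewrite adjC. Qed.

Lemma last_rev_belast x p z : last z (rev (belast x p)) = head z (belast x p).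
Proof. by case: (belast x p) => //= y q; rewrite rev_cons last_rcons. Qed.

(** Paths in a tree are determined by their end points: past their last common
    initial vertex, two different paths would close up to a cycle. *)
Lemma upath_inj x p q :
  upath x p -> upath x q -> last x p = last x q -> p = q.
Proof.
elim: p x q => [|y p IH] x [|y' q] //.
- by rewrite upath_cons => _ /and3P[_ + _] /= eq_l; rewrite eq_l mem_last.
- by rewrite upath_cons => /and3P[_ + _] _ /= eq_l; rewrite -eq_l mem_last.
rewrite !upath_cons => /and3P[exy xyp Up] /and3P[exy' xyq Uq] /= eq_l.
have [eyy'|neq] := eqVneq y y'.
  by rewrite -eyy' in Uq eq_l *; rewrite (IH y q).
(* Otherwise a path from y to y' avoiding x closes up to a cycle through x. *)
set r0 := p ++ rev (belast y' q).
have path_r0 : path e y r0.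
  rewrite cat_path; case/andP: Up => -> _ /=; rewrite eq_l.
  by apply: path_rev; case/andP: Uq.
have last_r0 : last y r0 = y'.
  rewrite last_cat eq_l last_rev_belast; case: (q) => //=.
have xr0 : x \notin y :: r0.
  rewrite inE mem_cat mem_rev !negb_or; move: xyp; rewrite inE negb_or.
  move=> /andP[-> ->] /=; apply: contra xyq; exact: mem_belast.
case/shortenP: path_r0 last_r0 => r path_r uniq_r sub_r last_r.
case: G_tree => _ _ _ /(_ (x :: y :: r)) acyc; case: r path_r uniq_r sub_r last_r acyc => /=.
  by move=> _ _ _ /eqP; rewrite (negPf neq).
move=> z r /andP[eyz path_r] uniq_r sub_r last_r acyc.
suff U : ucycle e [:: x, y, z & r] by have := acyc U.
rewrite /ucycle /= exy eyz rcons_path path_r last_r adjC exy' /=.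
move: uniq_r => /= ->; rewrite andbT.
apply: contra xr0; rewrite !inE => /orP[->//|xin]; apply/orP; right.
by apply: sub_r; rewrite inE.
Qed.

Lemma upath_exists u v : exists2 p, upath u p & last u p = v.
Proof.
have /connectP[p path_p ->] : connect e u v by case: G_tree => _ _ + _; apply.
by case/shortenP: path_p => r path_r uniq_r _; exists r; rewrite // /upath path_r.
Qed.

Lemma tpath_eq u p : upath u p -> tpath u (last u p) = p.
Proof.
move=> Up; rewrite /tpath.
case: xgetP => [q _ [path_q last_q uniq_q]|/(_ p) []].
  by apply: (upath_inj _ Up); rewrite /upath ?path_q.
by case/andP: Up.
Qed.

Lemma upath_rev x p : upath x p -> upath (last x p) (rev (belast x p)).
Proof.
case/andP=> path_p uniq_p; rewrite /upath path_rev //.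
by rewrite -rev_rcons -lastI rev_uniq.
Qed.

(** If the new vertex y were already on the path, the edge from y to w would be
    the only path between them, so y would be the predecessor of w. *)
Lemma upath_rcons x p w y :
  upath x (rcons p w) -> e w y -> y != last x p -> upath x (rcons (rcons p w) y).
Proof.
move=> /andP[path_p uniq_p] ewy ny.
rewrite /upath rcons_path path_p last_rcons ewy !andTb.
rewrite -rcons_cons rcons_uniq uniq_p andbT.
apply/negP => yin; move: path_p uniq_p ny.
have [z yz|] := eqVneq y w; first by move: ewy; rewrite z adjxx.
move=> nyw; have {}yin : y \in x :: p.
  by move: yin; rewrite -rcons_cons mem_rcons inE (negPf nyw).
case/splitPl: yin => p1 p2 last_p1.
rewrite rcons_cat cat_path last_p1 => /andP[_ path_p2] uniq_p.
have Up2 : upath y (rcons p2 w).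
  rewrite /upath path_p2 /=; move: uniq_p; rewrite -cat_cons lastI last_p1.
  by rewrite cat_rcons cat_uniq => /and3P[_ _].
have Uw : upath y [:: w].
  by rewrite /upath /= adjC ewy inE nyw.
have : rcons p2 w = [:: w] by apply: (upath_inj Up2 Uw); rewrite last_rcons.
move/(congr1 size); rewrite size_rcons => -[] /size0nil p20.
by rewrite p20 cats0 last_p1 eqxx.
Qed.

Lemma valency2_eq v x a b : valency v = 2%N -> e v x -> e v a -> e v b ->
  a != x -> b != x -> a = b.
Proof.
rewrite /valency => /eqP/cards2P[y [z [nyz E]]].
have H c : e v c = (c == y) || (c == z) by rewrite -in_set2 -E inE.
rewrite !H => /orP[]/eqP-> /orP[]/eqP-> /orP[]/eqP-> //; rewrite ?eqxx //.
Qed.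

(** q lists the interior vertices; the end points x and t are unrestricted. *)
Definition chain x q t := upath x (rcons q t) && all (fun v => valency v == 2%N) q.

Lemma chain_cons x y q t :
  chain x (y :: q) t = [&& e x y, x \notin rcons (y :: q) t, valency y == 2%N & chain y q t].
Proof.
rewrite /chain rcons_cons upath_cons /=.
by case: (e x y) => //=; case: (x \notin _) => //=; rewrite andbCA.
Qed.

Lemma chain_nil x t : chain x [::] t = e x t.
Proof.
rewrite /chain /= andbT /upath /= inE !andbT.
by case: eqP => [->|_]; rewrite ?adjxx ?andbT.
Qed.

Lemma chain_step x q t : chain x q t -> e x (head t q).
Proof.
case: q => [|y q]; first by rewrite chain_nil.
by rewrite chain_cons => /and4P[].
Qed.

Lemma chain_head_notin x q t : chain x q t -> x \notin rcons q t.
Proof. by case/andP => /andP[_ /=/andP[]]. Qed.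

(** At a vertex of valency 2 a path has only one way to go on, so a chain ending
    at a vertex of another valency is determined by its first edge. *)
Lemma chain_inj x q t q' t' : chain x q t -> chain x q' t' ->
  valency t != 2%N -> valency t' != 2%N -> head t q = head t' q' ->
  q = q' /\ t = t'.
Proof.
elim: q x q' => [|y q IH] x [|y' q'] //=.
- rewrite chain_cons => _ /and4P[_ _ + _] + _ ty.
  by rewrite ty => ->.
- rewrite chain_cons => /and4P[_ _ + _] _ _ + ty.
  by rewrite ty => ->.
rewrite !chain_cons => /and4P[exy xn vy C] /and4P[_ xn' _ C'] vt vt' yy'.
rewrite -{}yy' in xn' C' *.
have [|-> -> //] := IH y q' C C' vt vt'.
apply: (valency2_eq (eqP vy) (x := x)); rewrite 1?adjC ?(chain_step C) //.
- by rewrite adjC (chain_step C).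
- by rewrite adjC (chain_step C').
- apply: contra xn => /eqP <-; rewrite inE; apply/orP; right.
  by case: (q) => [|z r] /=; rewrite inE eqxx.
- apply: contra xn' => /eqP <-; rewrite inE; apply/orP; right.
  by case: (q') => [|z r] /=; rewrite inE eqxx.
Qed.

Lemma chain_rev x q t : chain x q t -> chain t (rev q) x.
Proof.
rewrite /chain => /andP[/upath_rev + vq]; rewrite last_rcons belast_rcons rev_cons => ->.
by rewrite all_rev.
Qed.

Lemma valency_gt0 u v : u != v -> (0 < valency u)%N.
Proof.
have [p Up <-] := upath_exists u v; case: p Up => [|w p]; first by rewrite eqxx.
rewrite upath_cons => /and3P[euw _ _] _.
by apply/card_gt0P; exists w; rewrite inE.
Qed.

Lemma upath_valency x p v q : upath x (p ++ v :: q) -> q != [::] ->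
  (2 <= valency v)%N.
Proof.
case: q => // y q /andP[] + + _; rewrite cat_path => /= /and3P[_ exv /andP[evy _]] U.
have nxy : last x p != y.
  apply/negP => /eqP exy.
  have : uniq ((x :: p) ++ [:: v, y & q]) by [].
  rewrite cat_uniq => /and3P[_ + _].
  by case/negP; apply/hasP; exists y; [rewrite !inE eqxx orbT | rewrite -exy; exact: mem_last].
rewrite /valency; have -> : 2%N = #|[set last x p; y]| by rewrite cards2 nxy.
apply/subset_leq_card/fintype.subsetP => z; rewrite !inE.
by case/orP => /eqP->; rewrite // adjC.
Qed.

Lemma upath_ext x p w : upath x (rcons p w) -> valency w = 2%N ->
  exists2 y, e w y & y != last x p.
Proof.
move=> U v2; have : (1 < #|[set y | e w y]|)%N by rewrite -/(valency w) v2.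
case/card_gt1P => a [b [+ + nab]]; rewrite !inE => ea eb.
have [ax|nax] := eqVneq a (last x p); last by exists a.
by exists b => //; rewrite -ax eq_sym.
Qed.

(** Going on through vertices of valency 2 never revisits a vertex, so it stops at
    a vertex of another valency. *)
Lemma chain_ext x q t : chain x q t -> exists q' t',
  [/\ chain x q' t', valency t' != 2%N & prefix (rcons q t) (rcons q' t')].
Proof.
have [k] := ubnP (#|G| - size q); elim: k q t => // k IH q t; rewrite ltnS => lek C.
have [v2|nv2] := eqVneq (valency t) 2; last by exists q, t; split=> //; exact: prefix_refl.
case/andP: (C) => U aq.
have [y ety ny] := upath_ext U v2.
have C' : chain x (rcons q t) y.
  by rewrite /chain upath_rcons //= all_rcons v2 eqxx.
have lt_q : (size q < #|G|)%N.
  case/andP: U => _ /= /andP[_ /card_uniqP].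
  rewrite size_rcons => <-; exact: max_card.
have [|q' [t' [C2 v2' P]]] := IH (rcons q t) y _ C'.
  by rewrite size_rcons; lia.
exists q', t'; split=> //; apply: prefix_trans P.
by rewrite -(cats1 _ y) prefix_prefix.
Qed.
End Tree.

(** * Nodes, ends and the chains joining them *)

Section Nodes.
Variable G : plumbing_graph.
Hypothesis G_tree : is_tree G.
Implicit Types (u v w x y t : G) (p q : seq G) (n m : node G).
Local Notation e := (@adj G).

Lemma head_rcons x q t : head x (rcons q t) = head t q.
Proof. by case: q. Qed.

Lemma chain_tpath x q t : chain x q t -> tpath x t = rcons q t.
Proof.
by case/andP => U _; have := tpath_eq G_tree U; rewrite last_rcons.
Qed.

Lemma chain_stepE x q t : chain x q t -> step x t = head t q.
Proof. by move=> C; rewrite /step (chain_tpath C) head_rcons. Qed.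

Lemma chain_ocE x q t : chain x q t -> path_oc x t = [set w in rcons q t].
Proof. by move=> C; rewrite /path_oc (chain_tpath C). Qed.

Lemma upath_interior x q t v : upath x (rcons q t) -> v \in q -> (2 <= valency v)%N.
Proof.
move=> + /splitPr def_q; case: def_q => q1 q2; rewrite rcons_cat rcons_cons.
by move=> /(upath_valency G_tree); apply; case: q2.
Qed.

Lemma upath_chain x q t : upath x (rcons q t) -> all (fun v => v \notin nodes G) q ->
  chain x q t.
Proof.
move=> U /allP nq; rewrite /chain U; apply/allP => v vq.
have := nq v vq; have := upath_interior U vq; rewrite inE -ltnNge ltnS => *.
by rewrite eqn_leq; apply/andP.
Qed.

Lemma chain_nonnode x q t v : chain x q t -> v \in q -> v \notin nodes G.
Proof. by case/andP => _ /allP aq /aq; rewrite inE => /eqP->. Qed.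

Lemma chain_val2 x q t v : chain x q t -> v \in q -> valency v = 2%N.
Proof. by case/andP => _ /allP aq /aq /eqP. Qed.

Lemma tpath_rcons x t : x != t -> exists2 q, upath x (rcons q t) & tpath x t = rcons q t.
Proof.
have [p U <-] := upath_exists G_tree x t.
case/lastP: p U => [|q t' U _]; first by rewrite eqxx.
by exists q; rewrite ?last_rcons // -[RHS](tpath_eq G_tree U) last_rcons.
Qed.

Lemma upath_ooE x q t : upath x (rcons q t) -> tpath x t = rcons q t ->
  path_oo x t = [set w in q].
Proof.
move=> U E; rewrite /path_oo /path_oc E; apply/setP => w.
rewrite !inE mem_rcons inE; case: eqVneq => //= ->; apply/esym/negP => tq.
by case/andP: U => _ /= /andP[_]; rewrite rcons_uniq tq.
Qed.

Lemma chain_ooE x q t : chain x q t -> path_oo x t = [set w in q].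
Proof. by move=> C; case/andP: (C) => U _; exact: upath_ooE U (chain_tpath C). Qed.

Lemma nbr_nodesP n m :
  reflect (exists q, chain (val n) q (val m)) (m \in nbr_nodes n).
Proof.
rewrite inE; apply: (iffP andP) => [[nm]|[q C]].
  have /tpath_rcons[q U E] : val n != val m by rewrite eq_sym (inj_eq val_inj).
  rewrite (upath_ooE U E) => D; exists q; apply: upath_chain => //.
  by apply/allP => v vq; rewrite (disjointFr D) // inE.
split; last first.
  rewrite (chain_ooE C) disjoint_subset; apply/fintype.subsetP => v.
  by rewrite inE => /(chain_nonnode C).
apply/eqP => mn; have := chain_head_notin C.
by rewrite mn mem_rcons inE eqxx.
Qed.

Lemma ends_nonnode u : u \in ends G -> u \notin nodes G.
Proof. by rewrite !inE => /eqP->. Qed.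

Lemma ends_val1 u : u \in ends G -> valency u = 1%N.
Proof. by rewrite inE => /eqP. Qed.

Lemma node_val3 n : (3 <= valency (val n))%N.
Proof. by have := valP n; rewrite /= inE. Qed.

Lemma node_val2F n : valency (val n) != 2%N.
Proof. by have := node_val3 n; case: eqP => // ->. Qed.

Lemma end_val2F u : u \in ends G -> valency u != 2%N.
Proof. by move/ends_val1 ->. Qed.

Lemma nbr_endsP n u :
  reflect (u \in ends G /\ exists q, chain (val n) q u) (u \in nbr_ends n).
Proof.
rewrite [X in reflect _ X]inE; apply: (iffP andP) => [[eu D]|[eu [q C]]]; split=> //.
  have /tpath_rcons[q U E] : val n != u.
    by apply/eqP => nu; have := ends_nonnode eu; rewrite -nu (valP n).
  exists q; apply: upath_chain => //.
  apply/allP => v vq; rewrite (disjointFr D) // inE E.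
  by rewrite mem_rcons inE vq orbT.
rewrite (chain_ocE C) disjoint_subset; apply/fintype.subsetP => v.
rewrite inE mem_rcons inE => /orP[/eqP->|/(chain_nonnode C)//].
exact: ends_nonnode.
Qed.

Lemma nbr_ends_end n u : u \in nbr_ends n -> u \in ends G.
Proof. by case/nbr_endsP. Qed.

Lemma nbr_nodes_sym n m : (m \in nbr_nodes n) = (n \in nbr_nodes m).
Proof.
by apply/nbr_nodesP/nbr_nodesP => -[q /(chain_rev G_tree) C]; exists (rev q).
Qed.

Lemma path_oo_sym n m : m \in nbr_nodes n ->
  path_oo (val n) (val m) = path_oo (val m) (val n).
Proof.
case/nbr_nodesP => q C; rewrite (chain_ooE C) (chain_ooE (chain_rev G_tree C)).
by apply/setP => v; rewrite !inE mem_rev.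
Qed.

(** The vertices of valency different from 2 that a chain joins to n. *)
Definition targets n : {set G} := [set val m | m in nbr_nodes n] :|: nbr_ends n.

Lemma targetsP n t :
  reflect (valency t != 2%N /\ exists q, chain (val n) q t) (t \in targets n).
Proof.
rewrite inE; apply: (iffP orP) => [[/imsetP[m /nbr_nodesP C ->]|/nbr_endsP[eu C]]|].
- by split=> //; exact: node_val2F.
- by split=> //; exact: end_val2F.
case=> v2 [q C]; have [tn|tn] := boolP (t \in nodes G).
  left; apply/imsetP; exists (exist _ t tn) => //.
  by apply/nbr_nodesP; exists q.
right; apply/nbr_endsP; split; last by exists q.
have : (0 < valency t)%N.
  apply: (@valency_gt0 _ G_tree _ (val n)); apply/eqP => tn'.
  by move: tn; rewrite tn' (valP n).
by move: tn v2; rewrite !inE; case: (valency t) => [|[|[|]]].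
Qed.

Lemma step_inj n : {in targets n &, injective (step (val n))}.
Proof.
move=> t t' /targetsP[vt [q C]] /targetsP[vt' [q' C']].
by rewrite (chain_stepE C) (chain_stepE C') => /(chain_inj G_tree C C' vt vt')[].
Qed.

(** Every edge at n is the first edge of exactly one chain ending at a node or an
    end; with step_inj this puts the neighbours of n in bijection with the
    neighbouring nodes and the ends of n. *)
Lemma step_targets n : [set step (val n) t | t in targets n] = [set w | e (val n) w].
Proof.
apply/setP => w; rewrite [RHS]inE; apply/imsetP/idP.
  by case=> t /targetsP[_ [q C]] ->; rewrite (chain_stepE C) (chain_step G_tree C).
move=> enw; have C : chain (val n) [::] w by rewrite chain_nil.
have [q [t [Cq vt P]]] := chain_ext G_tree C.
exists t; first by apply/targetsP; split=> //; exists q.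
rewrite (chain_stepE Cq); move: P; rewrite /=.
by case: (q) => [|z r] /=; rewrite ?prefix_cons; case: eqP.
Qed.

Lemma targets_disj n : [disjoint [set val m | m in nbr_nodes n] & nbr_ends n].
Proof.
rewrite disjoint_subset; apply/fintype.subsetP => t /imsetP[m _ ->].
rewrite !inE; apply/negP => /andP[/eqP v1 _].
by have := node_val3 m; rewrite v1.
Qed.

Lemma sum_nbrs (V : nmodType) (F : G -> V) n :
  \sum_(w | e (val n) w) F w =
    \sum_(m in nbr_nodes n) F (step (val n) (val m))
    + \sum_(u in nbr_ends n) F (step (val n) u).
Proof.
rewrite (eq_bigl (fun w => w \in [set w | e (val n) w])) => [|w]; last by rewrite inE.
rewrite -step_targets big_imset; last exact: step_inj.
rewrite (eq_bigl (fun t => t \in [predU [set val m | m in nbr_nodes n] & nbr_ends n])).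
  rewrite bigU ?targets_disj //= big_imset //= => m m' _ _; exact: val_inj.
by move=> t; rewrite [LHS]inE [RHS]inE.
Qed.

Lemma valencyE n : valency (val n) = (deltaN n + #|nbr_ends n|)%N.
Proof.
rewrite /deltaN /valency -!sum1_card -[RHS](sum_nbrs (fun=> 1%N)).
by apply: eq_bigl => w; rewrite inE.
Qed.

Hypothesis G_nodes : nodes G != finset.set0.

Lemma last_node r p : upath r p -> last r p \notin nodes G ->
  has (fun v => v \in nodes G) (r :: p) ->
  exists n q, chain (val n) q (last r p).
Proof.
elim: p r => [|y p IH] r; first by move=> /= _ /negPf ->.
move=> U nl; have [hp _|hp] := boolP (has (fun v => v \in nodes G) (y :: p)).
  by apply: (IH y) => //; move: U; rewrite upath_cons => /and3P[].
rewrite /= -/(has _ (y :: p)) (negPf hp) orbF => rn.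
exists (exist _ r rn), (belast y p); apply: upath_chain; first by rewrite -lastI.
by apply/allP => v /mem_belast vp; apply: (hasPn hp).
Qed.

(** A vertex that is not a node lies on a path issuing from the last node met on
    the way from a fixed node; this path is prolonged by chain_ext. *)
Lemma cover v : v \notin nodes G -> exists n q t,
  [/\ chain (val n) q t, valency t != 2%N & v \in rcons q t].
Proof.
move=> vn; have /set0Pn[r rn] := G_nodes.
have [p U lp] := upath_exists G_tree r v.
have := last_node U; rewrite lp /= rn => /(_ vn isT)[n [q C]].
have [q' [t [C' vt P]]] := chain_ext G_tree C.
exists n, q', t; split=> //; case/prefixP: P => r' ->.
by rewrite mem_cat mem_rcons inE eqxx.
Qed.

Lemma cover_node_end v : v \notin nodes G ->
  (exists n m, m \in nbr_nodes n /\ v \in path_oo (val n) (val m)) \/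
  (exists n u, u \in nbr_ends n /\ v \in path_oc (val n) u).
Proof.
move=> vn; have [n [q [t [C vt vq]]]] := cover vn.
have : t \in targets n by apply/targetsP; split=> //; exists q.
rewrite inE => /orP[/imsetP[m nm tm]|tu].
  left; exists n, m; split=> //; rewrite -tm (chain_ooE C) inE.
  by move: vq; rewrite mem_rcons inE => /orP[/eqP vt'|//]; move: vn; rewrite vt' tm (valP m).
by right; exists n, t; split=> //; rewrite (chain_ocE C) inE.
Qed.

Lemma end_owner u : u \in ends G -> exists n, u \in nbr_ends n.
Proof.
move=> eu; have [n [q [t [C vt]]]] := cover (ends_nonnode eu).
rewrite mem_rcons inE => /orP[/eqP ut|/(chain_val2 C)]; last by rewrite (ends_val1 eu).
by exists n; apply/nbr_endsP; split=> //; exists q; rewrite ut.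
Qed.

(** The chain from the end u to its node is read backwards from u, where there is
    only one edge. *)
Lemma end_owner_uniq u n n' : u \in nbr_ends n -> u \in nbr_ends n' -> n = n'.
Proof.
case/nbr_endsP => eu [q /(chain_rev G_tree) C] /nbr_endsP[_ [q' /(chain_rev G_tree) C']].
have /eqP/cards1P[w E] := ends_val1 eu.
have H y : e u y -> y = w by move=> euy; apply/set1P; rewrite -E inE.
apply: val_inj.
have [] // := chain_inj G_tree C C' (node_val2F n) (node_val2F n').
by rewrite (H _ (chain_step G_tree C)) (H _ (chain_step G_tree C')).
Qed.

Lemma owner_exists : {own : G -> node G |
  forall u n, u \in ends G -> (u \in nbr_ends n) = (own u == n)}.
Proof.
have [r rn] := sigW (set0Pn _ G_nodes).
exists (fun u => odflt (exist _ r rn) [pick n | u \in nbr_ends n]) => u n eu.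
case: pickP => [m um|no] /=; last by case: (end_owner eu) => m; rewrite no.
by apply/idP/eqP => [un|<-//]; apply: end_owner_uniq um un.
Qed.

End Nodes.

(** * Continuants and recurrences along chains *)

Section Continuant.
Variable G : plumbing_graph.
Hypothesis G_tree : is_tree G.
Implicit Types (u v w x y t : G) (p q : seq G) (n m : node G).
Local Notation e := (@adj G).

(** The continuant of the numbers - decoration v, that is, the determinant of the
    negative of the intersection matrix of a chain, expanded along its first row. *)
Fixpoint cont p : int :=
  if p is v :: p' then
    - decoration v * cont p' - (if p' is _ :: p'' then cont p'' else 0)
  else 1.

(** The convention for the empty chain matches omega = 0 for adjacent nodes. *)
Definition cont_tail p : int := if p is _ :: p' then cont p' else 0.

Lemma cont_cons v p : cont (v :: p) = - decoration v * cont p - cont_tail p.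
Proof. by []. Qed.

(** Continuants of numbers >= 2 increase strictly with the length. *)
Lemma cont_bounds p : (forall v, v \in p -> decoration v <= -2) ->
  0 <= cont_tail p < cont p.
Proof.
elim: p => [|v p IH] //= Hp.
have /IH/andP[c1 c0] w : w \in p -> decoration w <= -2.
  by move=> wp; apply: Hp; rewrite inE wp orbT.
have bv := Hp v (mem_head _ _).
rewrite (_ : match p with [::] => 0 | _ => _ end = cont_tail p) //.
by apply/andP; split; [lia | nia].
Qed.

(** A determinant does not depend on the enumeration of its index set; this is
    needed because gdet enumerates a set of vertices in an arbitrary order. *)
Lemma det_reindex (R : comNzRingType) (T : eqType) (F : T -> T -> R) (k l : nat)
    (f : 'I_k -> T) (g : 'I_l -> T) :
  injective f -> injective g -> (forall i, exists j, f i = g j) -> k = l ->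
  \det (\matrix_(i, j) F (f i) (f j)) = \det (\matrix_(i, j) F (g i) (g j)).
Proof.
move=> fI gI fg kl; case: l / kl g gI fg => g gI fg.
have fgb i : exists j, f i == g j by have [j ->] := fg i; exists j.
pose s i := xchoose (fgb i).
have fs i : f i = g (s i) by apply/eqP/(xchooseP (fgb i)).
have sI : injective s by move=> i j /(congr1 g); rewrite -!fs => /fI.
set M := (\matrix_(i, j) F (g i) (g j)).
have -> : \matrix_(i, j) F (f i) (f j) = row_perm (perm sI) (col_perm (perm sI) M).
  by apply/matrixP => i j; rewrite !mxE !permE -!fs.
rewrite row_permE col_permE !det_mulmx !det_perm odd_permV mulrCA.
by rewrite -signr_addb addbb mulr1.
Qed.

Definition seq_mx x0 p :=
  \matrix_(i < size p, j < size p) - inter (nth x0 p i) (nth x0 p j).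

Lemma gdet_seq x0 p : uniq p -> gdet [set w in p] = \det (seq_mx x0 p).
Proof.
move=> Up; rewrite /gdet /seq_mx.
have sz : #|[set w in p]| = size p by rewrite cardsE; apply/card_uniqP.
apply: (@det_reindex _ _ (fun a b => - inter a b) _ _ enum_val
          (fun i : 'I_(size p) => nth x0 p i)) => //.
- exact: enum_val_inj.
- by move=> i j /eqP; rewrite nth_uniq // => /eqP/val_inj.
move=> i; have := enum_valP i; rewrite inE -index_mem => ip.
by exists (Ordinal ip); rewrite /= nth_index // -index_mem.
Qed.

(** The only edges between the listed vertices join consecutive ones, so that the
    intersection matrix of the list is tridiagonal. *)
Fixpoint induced_path p : bool :=
  if p is v :: p' then
    all (fun w => e v w == (w == head v p')) p' && induced_path p'
  else true.

Lemma seq_mx_det x0 p : uniq p -> induced_path p -> \det (seq_mx x0 p) = cont p.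
Proof.
have [k] := ubnP (size p); elim: k p => // k IH [|v [|w p]] lek Up Ip.
- by rewrite det_mx00.
- rewrite (expand_det_row _ ord0) big_ord1 mxE /= /cofactor det_mx00.
  by rewrite /inter eqxx /= !mulr1 subr0.
have [vw vp] : v != w /\ (forall a, a \in p -> v != a).
  move: Up => /= /andP[]; rewrite inE negb_or => /andP[vw /negP vp] _.
  by split=> // a ap; apply/eqP => va; apply: vp; rewrite va.
have [Uw Up'] : uniq (w :: p) /\ uniq p by move: Up => /= /and3P[_ -> ->].
have [Iw Ip'] : induced_path (w :: p) /\ induced_path p.
  by move: Ip => /= /and3P[_ -> ->].
have [evw evp] : e v w /\ (forall a, a \in p -> e v a = false).
  move: Ip => /= /andP[/andP[/eqP-> /allP H] _]; rewrite eqxx; split=> // a ap.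
  rewrite (eqP (H a ap)); apply/eqP => aw; move: Uw => /=.
  by rewrite -aw ap.
rewrite cont_cons /cont_tail -(IH (w :: p)) // -(IH p) //; last exact: ltnW.
set A := seq_mx x0 [:: v, w & p].
have A00 : A ord0 ord0 = - decoration v by rewrite mxE /= /inter eqxx.
have A01 : A ord0 (lift ord0 ord0) = -1.
  by rewrite mxE /= /inter (negPf vw) evw.
have A0i (i : 'I_(size p)) : A ord0 (lift ord0 (lift ord0 i)) = 0.
  rewrite mxE; change (- inter v (nth x0 p i) = 0).
  by rewrite /inter (negPf (vp _ _)) ?evp ?mem_nth ?oppr0.
rewrite (expand_det_row A ord0) 2!big_ord_recl big1 ?addr0; last first.
  by move=> i _; rewrite A0i mul0r.
rewrite A00 A01 /cofactor /= expr0 mul1r /bump /= !addn0 expr1 !mulN1r opprK.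
congr (_ * _ + _).
  by congr (\det _); apply/matrixP => i j; rewrite !mxE.
set B := row' _ _.
have B00 : B ord0 ord0 = -1.
  by rewrite !mxE /= /inter eq_sym (negPf vw) (adjC G_tree) evw.
have Bi0 (i : 'I_(size p)) : B (lift ord0 i) ord0 = 0.
  rewrite !mxE; change (- inter (nth x0 p i) v = 0).
  by rewrite /inter eq_sym (adjC G_tree) (negPf (vp _ _)) ?evp ?mem_nth ?oppr0.
rewrite (expand_det_col B ord0) big_ord_recl big1 ?addr0; last first.
  by move=> i _; rewrite Bi0 mul0r.
rewrite B00 mulN1r /cofactor /= expr0 mul1r; congr (- \det _).
by apply/matrixP => i j; rewrite !mxE.
Qed.

Lemma gdet_cont p : uniq p -> induced_path p -> gdet [set w in p] = cont p.
Proof.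
case: p => [|x0 p] Up Ip; last by rewrite (gdet_seq x0) ?seq_mx_det.
have det0 k (A : 'M[int]_k) : k = 0%N -> \det A = 1.
  by move=> k0; subst k; exact: det_mx00.
by rewrite /gdet det0 //; apply: eq_card0 => w; rewrite inE.
Qed.

Lemma induced_rcons q t : induced_path (rcons q t) -> induced_path q.
Proof.
elim: q => [|v q IH] //= /andP[H /IH ->]; rewrite andbT.
by case: q H {IH} => [|w q] //= /andP[->]; rewrite all_rcons => /andP[_].
Qed.

Lemma valency2_adj v x y w : valency v = 2%N -> e v x -> e v y -> x != y ->
  e v w = (w == x) || (w == y).
Proof.
move=> v2 vx vy nxy; apply/idP/orP => [vw|[]/eqP-> //].
have [->|nwx] := eqVneq w x; [by left | right].
by apply/eqP; apply: (valency2_eq v2 vx vw vy nwx); rewrite eq_sym.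
Qed.

Lemma chain_prev_next x v q t : chain x (v :: q) t ->
  [/\ valency v = 2%N, e v x, e v (head t q), x != head t q & x \notin rcons q t].
Proof.
rewrite chain_cons => /and4P[exv xn /eqP v2 C]; split=> //.
- by rewrite (adjC G_tree).
- exact: chain_step C.
- apply: contra xn => /eqP->; rewrite inE; apply/orP; right.
  by case: (q) => [|z r] /=; rewrite inE eqxx.
- by move: xn; rewrite inE negb_or => /andP[].
Qed.

Lemma chain_induced x q t : chain x q t -> induced_path (rcons q t).
Proof.
elim: q x => [|v q IH] x // C; have [v2 evx evh xh xn] := chain_prev_next C.
move: C; rewrite chain_cons => /and4P[_ _ _ C] /=; rewrite (IH v) // andbT.
apply/allP => w wq; rewrite (valency2_adj w v2 evx evh xh) head_rcons.
by case: (eqVneq w x) => [wx|//]; move: xn; rewrite -wx wq.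
Qed.

Lemma chain_uniq x q t : chain x q t -> uniq (rcons q t).
Proof. by case/andP => /andP[_ /= /andP[]]. Qed.

Lemma alphaE n m q : chain (val n) q (val m) -> alpha n m = cont q.
Proof.
move=> C; rewrite /alpha (chain_ooE G_tree C) gdet_cont //.
  by have := chain_uniq C; rewrite rcons_uniq => /andP[].
exact: induced_rcons (chain_induced C).
Qed.

Lemma set_behead v p : uniq (v :: p) -> [set w in v :: p] :\ v = [set w in p].
Proof.
move=> /= /andP[vp _]; apply/setP => w; rewrite !inE.
by case: eqVneq => //= ->; rewrite (negPf vp).
Qed.

Lemma omegaE n m q : chain (val n) q (val m) -> omega n m = cont_tail q.
Proof.
move=> C; rewrite /omega (chain_ooE G_tree C) (chain_stepE G_tree C).
case: q C => [|v q] C.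
  by case: eqP => // -[]; apply/setP => w; rewrite !inE.
case: eqP => [/setP/(_ v)|_]; first by rewrite !inE eqxx.
have := chain_uniq C; rewrite rcons_uniq => /andP[_ Uq].
rewrite set_behead // gdet_cont //; first by case/andP: Uq.
by have /= /andP[] := induced_rcons (chain_induced C).
Qed.

Lemma alpha_endE n u q : chain (val n) q u -> alpha_end n u = cont (rcons q u).
Proof.
by move=> C; rewrite /alpha_end (chain_ocE G_tree C) gdet_cont ?(chain_uniq C) ?(chain_induced C).
Qed.

Lemma omega_endE n u q : chain (val n) q u -> omega_end n u = cont_tail (rcons q u).
Proof.
move=> C; rewrite /omega_end (chain_ocE G_tree C) (chain_stepE G_tree C).
have := chain_uniq C; have := chain_induced C.
case: q C => [|v q] C; first by move=> _ U; rewrite set_behead // gdet_cont.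
by move=> /andP[_ I] U; rewrite set_behead // gdet_cont //; case/andP: U.
Qed.

Section Walk.
(* Both F = rat (for the lattices) and F = R (for the cone) are used. *)
Variable F : numFieldType.
Implicit Types (z d : G -> F).

(** The number d_v(z) = -(z, E_v), called the source of z at v. *)
Definition lap z v : F := - (decoration v)%:~R * z v - \sum_(w | e v w) z w.

(** The contribution of the sources d along a chain p to the recurrence solved in
    recur_cont. *)
Fixpoint src d p : F :=
  if p is v :: p' then (cont p')%:~R * d v + src d p' else 0.

(** The sources of z along p are given by a three-term recurrence, where x precedes
    p and tau is the value of z after p; tau = 0 when p stops at an end. *)
Fixpoint recur z (tau : F) x p : Prop :=
  if p is v :: p' then
    lap z v = - (decoration v)%:~R * z v - z x - head tau (map z p') /\
    recur z tau v p'
  else True.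

(** The solution of the recurrence: continuants satisfy the same one. *)
Lemma recur_cont z tau x p : recur z tau x p ->
  (cont p)%:~R * head tau (map z p) = tau + (cont_tail p)%:~R * z x + src (lap z) p.
Proof.
elim: p x => [|v p IH] x; first by move=> _; rewrite /= mul1r mul0r !addr0.
case=> lapv /IH IHv; rewrite cont_cons /cont_tail [src _ _]/= -/(cont_tail p).
rewrite rmorphB rmorphM rmorphN /= lapv; move: IHv.
move: (head tau _) (src _ _) (cont p)%:~R (cont_tail p)%:~R => h s a b E.
have -> : s = a * h - tau - b * z v by rewrite E; ring.
ring.
Qed.

Lemma sum_val2 z v x y : valency v = 2%N -> e v x -> e v y -> x != y ->
  \sum_(w | e v w) z w = z x + z y.
Proof.
move=> v2 vx vy nxy.
rewrite (bigD1 x) //= (bigD1 y) ?vy 1?eq_sym //= big1 ?addr0 // => w.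
by rewrite (valency2_adj w v2 vx vy nxy) => /andP[/andP[/orP[]->]]; rewrite ?andbF.
Qed.

Lemma chain_recur z x q t : chain x q t -> recur z (z t) x q.
Proof.
elim: q x => [|v q IH] x // C; have [v2 vx vh xh _] := chain_prev_next C.
move: C; rewrite chain_cons => /and4P[_ _ _ C]; split; last exact: IH.
rewrite /lap (sum_val2 z v2 vx vh xh) opprD addrA; congr (_ - _).
by case: (q).
Qed.

Lemma leg_recur z x q u : u \in ends G -> chain x q u -> recur z 0 x (rcons q u).
Proof.
move=> eu; elim: q x => [|v q IH] x C.
  split=> //; rewrite /= subr0 /lap; congr (_ - _).
  have /eqP/cards1P[w E] := ends_val1 eu.
  have H y : e u y = (y == w) by move/setP/(_ y): E; rewrite !inE.
  rewrite (eq_bigl _ _ H) big_pred1_eq; congr z; apply/esym/eqP; rewrite -H.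
  by rewrite (adjC G_tree) -chain_nil.
have [v2 vx vh xh _] := chain_prev_next C.
move: C; rewrite chain_cons => /and4P[_ _ _ C]; split; last exact: IH.
rewrite /lap (sum_val2 z v2 vx vh xh) opprD addrA; congr (_ - _).
by case: (q).
Qed.

Lemma src_eq d d' p : {in p, d =1 d'} -> src d p = src d' p.
Proof.
elim: p => [|v p IH] //= H; rewrite H ?mem_head // IH // => w wp.
by apply: H; rewrite inE wp orbT.
Qed.

Lemma src_ge0 d p : (forall v, v \in p -> decoration v <= -2) ->
  (forall v, v \in p -> 0 <= d v) -> 0 <= src d p.
Proof.
elim: p => [|v p IH] //= Hp Hd.
have Hp' w : w \in p -> decoration w <= -2.
  by move=> wp; apply: Hp; rewrite inE wp orbT.
rewrite addr_ge0 ?mulr_ge0 ?Hd ?mem_head //; last first.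
  by apply: IH => // w wp; apply: Hd; rewrite inE wp orbT.
by rewrite ler0z; have /andP[c1 c0] := cont_bounds Hp'; apply: le_trans c1 (ltW c0).
Qed.

Lemma src_last d p v : uniq (rcons p v) -> (forall w, w \in p -> d w = 0) ->
  src d (rcons p v) = d v.
Proof.
elim: p => [|w p IH] /=; first by rewrite mul1r addr0.
case/andP => _ U H; rewrite H ?mem_head // mulr0 add0r IH // => y yp.
by apply: H; rewrite inE yp orbT.
Qed.

Lemma src0 d p : (forall w, w \in p -> d w = 0) -> src d p = 0.
Proof.
elim: p => [|w p IH] //= H; rewrite H ?mem_head // mulr0 add0r IH // => y yp.
by apply: H; rewrite inE yp orbT.
Qed.

Lemma src_opp d p : src (fun v => - d v) p = - src d p.
Proof. by elim: p => [|v p IH] /=; rewrite ?oppr0 // IH opprD mulrN. Qed.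

End Walk.

Lemma recur_int (z : G -> rat) tau x p : recur z tau x p ->
  z x \is a Num.int -> head tau (map z p) \is a Num.int ->
  (forall v, v \in p -> lap z v \is a Num.int) ->
  forall v, v \in p -> z v \is a Num.int.
Proof.
elim: p x => [|v p IH] x // [lapv R] zx /= zv H w.
rewrite inE => /orP[/eqP->//|]; apply: (IH v) => //.
  have -> : head tau (map z p) = - (decoration v)%:~R * z v - z x - lap z v.
    by rewrite lapv; ring.
  apply: rpredB; last by apply: H; rewrite mem_head.
  by apply: rpredB => //; apply: rpredM => //; rewrite rpredN intr_int.
by move=> y yp; apply: H; rewrite inE yp orbT.
Qed.

End Continuant.

(** * Square linear systems *)

Section Square.
Variables (F : fieldType) (I : finType) (A : I -> I -> F).

Let M : 'M[F]_#|I| := \matrix_(i, j) A (enum_val i) (enum_val j).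

Let applyE (s : I -> F) i :
  \sum_j A i j * s j = (M *m \col_j s (enum_val j)) (enum_rank i) 0.
Proof.
rewrite mxE (reindex (@enum_val I I)) /=; last first.
  by apply: onW_bij; exact: enum_val_bij.
by apply: eq_bigr => j _; rewrite !mxE enum_rankK.
Qed.

Lemma square_surj_inj :
  (forall x : I -> F, exists s, forall i, \sum_j A i j * s j = x i) ->
  forall s, (forall i, \sum_j A i j * s j = 0) -> forall i, s i = 0.
Proof.
move=> surj s s0 i.
have /choice[B BP] k : exists s, forall i, \sum_j A i j * s j = (i == k)%:R.
  exact: (surj (fun i => (i == k)%:R)).
pose N : 'M[F]_#|I| := \matrix_(i, j) B (enum_val j) (enum_val i).
have MN : M *m N = 1%:M.
  apply/matrixP => a b; rewrite mxE [RHS]mxE.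
  have := BP (enum_val b) (enum_val a).
  rewrite applyE mxE enum_valK (inj_eq enum_val_inj) => <-.
  by apply: eq_bigr => j _; rewrite !mxE.
have Ms : M *m \col_j s (enum_val j) = 0.
  by apply/colP => a; rewrite [RHS]mxE -[a]enum_valK -applyE s0.
have /(congr1 (fun B : 'cV_#|I| => B (enum_rank i) 0)) :
    \col_j s (enum_val j) = N *m (M *m \col_j s (enum_val j)).
  by rewrite mulmxA (mulmx1C MN) mul1mx.
by rewrite Ms mulmx0 !mxE enum_rankK.
Qed.

Lemma square_inj_surj :
  (forall s, (forall i, \sum_j A i j * s j = 0) -> forall i, s i = 0) ->
  forall x : I -> F, exists s, forall i, \sum_j A i j * s j = x i.
Proof.
move=> inj x.
have Mu : M \in unitmx.
  rewrite -unitmx_tr -row_free_unit -kermx_eq0; apply/eqP/row_matrixP => k.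
  rewrite row0; set r := row k _.
  have r0 : M *m r^T = 0.
    by apply: trmx_inj; rewrite trmx_mul trmxK trmx0 -row_mul mulmx_ker row0.
  apply/rowP => j; rewrite [RHS]mxE -[j]enum_valK.
  apply: (inj (fun i => r 0 (enum_rank i))) => i; rewrite applyE.
  rewrite [X in M *m X](_ : _ = r^T) ?r0 ?mxE //.
  by apply/colP => a; rewrite !mxE enum_valK.
exists (fun i => (invmx M *m \col_j x (enum_val j)) (enum_rank i) 0) => i.
rewrite applyE [X in M *m X](_ : _ = invmx M *m \col_j x (enum_val j)).
  by rewrite mulmxA mulmxV // mul1mx mxE enum_rankK.
by apply/colP => a; rewrite mxE enum_valK.
Qed.

End Square.

(** * Vectors with prescribed sources *)

Section Laplacian.
Variable G : plumbing_graph.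
Hypothesis G_tree : is_tree G.
Implicit Types (u v w x y t : G) (p q : seq G) (n m : node G).

Section Field.
Variable F : numFieldType.

Lemma sum_inter (z : G -> F) v :
  \sum_w (inter v w)%:~R * z w = - lap z v.
Proof.
rewrite (bigD1 v) //= /lap opprD opprK mulNr opprK; congr (_ * _ + _).
  by rewrite /inter eqxx.
rewrite (big_mkcond (fun w => adj v w)) (big_mkcond (fun w => w != v)) /=.
apply: eq_bigr => w _; rewrite /inter eq_sym.
case: eqVneq => [->|_]; first by rewrite (adjxx G_tree).
by case: (adj v w); rewrite ?mul1r ?mul0r.
Qed.

Lemma inter_sym v w : inter v w = inter w v :> int.
Proof. by rewrite /inter eq_sym (adjC G_tree); case: eqP => // ->. Qed.

Lemma form_basisE (z : {ffun G -> F}) v : Defs.form z (basisE F v) = - lap z v.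
Proof.
rewrite /Defs.form -sum_inter; apply: eq_bigr => w _; rewrite (bigD1 v) //= big1.
  by rewrite ffunE eqxx mulr1 addr0 mulrC inter_sym.
by move=> a /negPf av; rewrite ffunE av mulr0.
Qed.

Lemma lap_eq (z z' : G -> F) v : z =1 z' -> lap z v = lap z' v.
Proof.
by move=> E; rewrite /lap E; congr (_ - _); apply: eq_bigr => w _.
Qed.

Lemma lapB (z z' : G -> F) v : lap (fun w => z w - z' w) v = lap z v - lap z' v.
Proof. by rewrite /lap sumrB; ring. Qed.

Lemma lap_comb (I : finType) (c : I -> F) (z : I -> G -> F) v :
  lap (fun w => \sum_i c i * z i w) v = \sum_i c i * lap (z i) v.
Proof.
rewrite /lap exchange_big mulr_sumr -sumrB; apply: eq_bigr => i _ /=.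
by rewrite -mulr_sumr; ring.
Qed.

End Field.

Hypothesis G_negdef : negative_definite G.

(** After clearing denominators, a vector without sources is an integral vector
    orthogonal to itself. *)
Lemma lap_inj (z : G -> rat) : (forall v, lap z v = 0) -> forall v, z v = 0.
Proof.
move=> z0.
pose D : int := \prod_v denq (z v).
have D0 : D%:~R != 0 :> rat.
  rewrite intr_eq0; apply/prodf_neq0 => v _; exact: denq_neq0.
have /choice[l lP] v : exists k : int, k%:~R = D%:~R * z v.
  exists (numq (z v) * \prod_(w | w != v) denq (z w)).
  rewrite /D [in RHS](bigD1 v) //= !intrM -[X in _ = _ * X]divq_num_den.
  have: (denq (z v))%:~R != 0 :> rat by rewrite intr_eq0 denq_neq0.
  by move: (denq _)%:~R (numq _)%:~R (\prod_(w | _) _)%:~R => d k P d0; field.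
have [l0 v|l0] := eqVneq (finfun l) 0.
  have /eqP := lP v; rewrite (_ : l v = 0); last first.
    by move/ffunP/(_ v): l0; rewrite !ffunE.
  by rewrite eq_sym mulf_eq0 (negPf D0) => /eqP.
have := G_negdef l0; rewrite -(ltr_int rat).
suff -> : (Defs.form (finfun l) (finfun l))%:~R = 0 :> rat by rewrite ltxx.
rewrite /Defs.form rmorph_sum big1 // => v _; rewrite rmorph_sum /=.
rewrite (eq_bigr (fun w => (l v)%:~R * (D%:~R * ((inter v w)%:~R * z w)))).
  by rewrite -!mulr_sumr sum_inter z0 oppr0 !mulr0.
move=> w _; rewrite !ffunE !intrM (lP w) intz; ring.
Qed.

Lemma lap_surj (f : G -> rat) : exists z : {ffun G -> rat}, forall v, lap z v = f v.
Proof.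
have [s sP] : exists s, forall i, \sum_j (inter i j)%:~R * s j = - f i.
  apply: square_inj_surj => s s0; apply: lap_inj => v.
  by apply/eqP; rewrite -oppr_eq0 -sum_inter s0.
exists (finfun s) => v; apply: oppr_inj; rewrite -sP -sum_inter.
by apply: eq_bigr => w _; rewrite ffunE.
Qed.

Lemma lap_Estar v w : lap (@Estar G v) w = (v == w)%:R.
Proof.
have [z zP] := lap_surj (fun w => (v == w)%:R).
rewrite /Estar; case: xgetP => [y _ /(_ w)|/(_ z)[]].
  by rewrite form_basisE => /eqP; rewrite eqr_oppLR => /eqP ->; case: (v == w); rewrite ?opprK ?oppr0.
by move=> u /=; rewrite form_basisE zP; case: (v == u); rewrite ?oppr0.
Qed.


End Laplacian.

(** * Elimination of the chains *)

Section NodeEquation.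
Variable G : plumbing_graph.
Hypothesis G_tree : is_tree G.
Hypothesis G_min : minimal_good G.
Implicit Types (u v w x y t : G) (p q : seq G) (n m : node G).

Definition inner n m : seq G :=
  if tpath (val n) (val m) is y :: p then belast y p else [::].

Lemma chain_inner n q m : chain (val n) q (val m) -> inner n m = q.
Proof.
move=> C; rewrite /inner (chain_tpath G_tree C).
by case: q C => [|y q] _ //=; rewrite belast_rcons.
Qed.

Lemma innerP n m : m \in nbr_nodes n -> chain (val n) (inner n m) (val m).
Proof. by case/(nbr_nodesP G_tree) => q C; rewrite (chain_inner C). Qed.

Lemma inner_sym n m : m \in nbr_nodes n -> inner m n = rev (inner n m).
Proof. by move/innerP/(chain_rev G_tree)/chain_inner. Qed.

Lemma legP n u : u \in nbr_ends n ->
  exists2 q, chain (val n) q u & tpath (val n) u = rcons q u.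
Proof.
by case/(nbr_endsP G_tree) => _ [q C]; exists q; rewrite ?(chain_tpath G_tree C).
Qed.

Lemma nonnode_decoration v : v \notin nodes G -> decoration v <= -2.
Proof. by rewrite inE -ltnNge => /G_min. Qed.

Lemma inner_nonnode n m v : m \in nbr_nodes n -> v \in inner n m -> v \notin nodes G.
Proof. by move/innerP; exact: chain_nonnode. Qed.

Lemma leg_nonnode n u v : u \in nbr_ends n -> v \in tpath (val n) u -> v \notin nodes G.
Proof.
move=> un; have [q C ->] := legP un.
rewrite mem_rcons inE => /orP[/eqP->|]; last exact: chain_nonnode C.
exact/ends_nonnode/(nbr_ends_end G_tree un).
Qed.

Lemma alpha_inner n m : m \in nbr_nodes n -> alpha n m = cont (inner n m).
Proof. by move/innerP/(alphaE G_tree). Qed.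

Lemma omega_inner n m : m \in nbr_nodes n -> omega n m = cont_tail (inner n m).
Proof. by move/innerP/(omegaE G_tree). Qed.

Lemma alpha_leg n u : u \in nbr_ends n -> alpha_end n u = cont (tpath (val n) u).
Proof. by move/legP => [q C ->]; apply: alpha_endE. Qed.

Lemma omega_leg n u : u \in nbr_ends n -> omega_end n u = cont_tail (tpath (val n) u).
Proof. by move/legP => [q C ->]; apply: omega_endE. Qed.

Lemma cont_gt0 p : (forall v, v \in p -> v \notin nodes G) -> 0 < cont p.
Proof.
move=> H; have /andP[] : 0 <= cont_tail p < cont p.
  by apply: cont_bounds => v /H; exact: nonnode_decoration.
exact: le_lt_trans.
Qed.

(** Positivity comes from the decorations, which are at most -2 on chains by
    minimality. *)
Lemma alpha_gt0 n m : m \in nbr_nodes n -> 0 < alpha n m.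
Proof. by move=> nm; rewrite alpha_inner // cont_gt0 // => v; exact: inner_nonnode. Qed.

Lemma alpha_end_gt0 n u : u \in nbr_ends n -> 0 < alpha_end n u.
Proof. by move=> nu; rewrite alpha_leg // cont_gt0 // => v; exact: leg_nonnode. Qed.

Lemma alpha_sym n m : m \in nbr_nodes n -> alpha m n = alpha n m.
Proof. by move=> nm; rewrite /alpha (path_oo_sym G_tree nm). Qed.

Section Field.
Variable F : numFieldType.
Implicit Type z : G -> F.

Lemma edge_eq z n m : m \in nbr_nodes n ->
  (alpha n m)%:~R * z (step (val n) (val m)) =
  z (val m) + (omega n m)%:~R * z (val n) + src (lap z) (inner n m).
Proof.
move=> nm; have C := innerP nm.
rewrite (alpha_inner nm) (omega_inner nm) -(recur_cont (chain_recur G_tree z C)).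
by rewrite (chain_stepE G_tree C); case: (inner n m).
Qed.

Lemma leg_eq z n u : u \in nbr_ends n ->
  (alpha_end n u)%:~R * z (step (val n) u) =
  (omega_end n u)%:~R * z (val n) + src (lap z) (tpath (val n) u).
Proof.
move=> nu; have [q C E] := legP nu; have eu := nbr_ends_end G_tree nu.
rewrite (alpha_leg nu) (omega_leg nu) E.
have := recur_cont (leg_recur G_tree z eu C); rewrite add0r => <-.
by rewrite (chain_stepE G_tree C); case: (q).
Qed.

(** The linear part of N-bar, as a function of the coordinates at the nodes. *)
Definition Nlin (x : node G -> F) n : F :=
  - ((decoration (val n))%:~R
     + \sum_(m in nbr_nodes n) (omega n m)%:~R / (alpha n m)%:~R
     + \sum_(u in nbr_ends n) (omega_end n u)%:~R / (alpha_end n u)%:~R) * x n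
  - \sum_(m in nbr_nodes n) x m / (alpha n m)%:~R.

(** The neighbours of n lie on the chains and legs issuing from n, where edge_eq
    and leg_eq express their coordinates by those at the nodes. *)
Lemma node_eq z n :
  lap z (val n) = Nlin (fun m => z (val m)) n
    - \sum_(m in nbr_nodes n) src (lap z) (inner n m) / (alpha n m)%:~R
    - \sum_(u in nbr_ends n) src (lap z) (tpath (val n) u) / (alpha_end n u)%:~R.
Proof.
rewrite {1}/lap (sum_nbrs G_tree) /Nlin.
set A := \sum_(m in _) z _; set B := \sum_(u in _) z _.
have -> : A = (\sum_(m in nbr_nodes n) (omega n m)%:~R / (alpha n m)%:~R) * z (val n)
    + \sum_(m in nbr_nodes n) z (val m) / (alpha n m)%:~R
    + \sum_(m in nbr_nodes n) src (lap z) (inner n m) / (alpha n m)%:~R.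
  rewrite mulr_suml -!big_split; apply: eq_bigr => m nm /=.
  have a0 : (alpha n m)%:~R != 0 :> F by rewrite intr_eq0 gt_eqF ?alpha_gt0.
  apply: (mulfI a0); rewrite edge_eq //; move: (src _ _) => s.
  by move: (alpha n m)%:~R a0 => a a0; field.
have -> : B = (\sum_(u in nbr_ends n) (omega_end n u)%:~R / (alpha_end n u)%:~R) * z (val n)
    + \sum_(u in nbr_ends n) src (lap z) (tpath (val n) u) / (alpha_end n u)%:~R.
  rewrite mulr_suml -!big_split; apply: eq_bigr => u nu /=.
  have a0 : (alpha_end n u)%:~R != 0 :> F by rewrite intr_eq0 gt_eqF ?alpha_end_gt0.
  apply: (mulfI a0); rewrite leg_eq //; move: (src _ _) => s.
  by move: (alpha_end n u)%:~R a0 => a a0; field.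
ring.
Qed.

Lemma Nlin_harmonic z n : (forall v, v \notin nodes G -> lap z v = 0) ->
  lap z (val n) = Nlin (fun m => z (val m)) n.
Proof.
move=> H; rewrite node_eq !big1 ?subr0 // => [u nu|m nm].
  by rewrite src0 ?mul0r // => v /(leg_nonnode nu)/H.
by rewrite src0 ?mul0r // => v /(inner_nonnode nm)/H.
Qed.

(** Sources on the chains enter node_eq with nonnegative weights. *)
Lemma Nlin_super z n : (forall v, v \notin nodes G -> 0 <= lap z v) ->
  lap z (val n) <= Nlin (fun m => z (val m)) n.
Proof.
move=> H; rewrite node_eq -addrA -opprD gerDl oppr_le0.
apply: addr_ge0; apply: sumr_ge0 => t nt; apply: divr_ge0.
- apply: src_ge0 => v /(inner_nonnode nt); [exact: nonnode_decoration | exact: H].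
- by rewrite ler0z ltW ?alpha_gt0.
- apply: src_ge0 => v /(leg_nonnode nt); [exact: nonnode_decoration | exact: H].
- by rewrite ler0z ltW ?alpha_end_gt0.
Qed.

Lemma eq_Nlin (x y : node G -> F) n : x =1 y -> Nlin x n = Nlin y n.
Proof.
move=> E; rewrite /Nlin E; congr (_ - _).
by apply: eq_bigr => m _; rewrite E.
Qed.

Lemma NlinB (x y : node G -> F) n : Nlin (fun m => x m - y m) n = Nlin x n - Nlin y n.
Proof.
rewrite /Nlin; under [X in _ - X = _]eq_bigr do rewrite mulrBl.
by rewrite sumrB; ring.
Qed.

Lemma NlinD (x y : node G -> F) n : Nlin (fun m => x m + y m) n = Nlin x n + Nlin y n.
Proof.
rewrite /Nlin; under [X in _ - X = _]eq_bigr do rewrite mulrDl.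
by rewrite big_split /=; ring.
Qed.

Definition Nlin_mx n m : F :=
  (n == m)%:R * - ((decoration (val n))%:~R
     + \sum_(m in nbr_nodes n) (omega n m)%:~R / (alpha n m)%:~R
     + \sum_(u in nbr_ends n) (omega_end n u)%:~R / (alpha_end n u)%:~R)
  - (m \in nbr_nodes n)%:R / (alpha n m)%:~R.

Lemma Nlin_mxE (x : node G -> F) n : \sum_m Nlin_mx n m * x m = Nlin x n.
Proof.
rewrite /Nlin; under eq_bigr do rewrite /Nlin_mx mulrBl.
set D := - (_ + _ + _); rewrite sumrB (bigD1 n) //= eqxx mul1r big1 ?addr0; last first.
  by move=> m; rewrite eq_sym => /negPf->; rewrite !mul0r.
congr (_ - _); rewrite [RHS]big_mkcond; apply: eq_bigr => m _.
by case: (m \in _); rewrite ?mul0r // mul1r mulrC.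
Qed.

(* E v stands for the dual vector E_v^* with coefficients in F. *)
Variable E : G -> G -> F.
Hypothesis lapE : forall v w, lap (E v) w = (v == w)%:R.

Definition node_comb (d : node G -> F) v : F := \sum_n d n * E (val n) v.

Lemma lap_node_comb d v : lap (node_comb d) v = \sum_n d n * (val n == v)%:R.
Proof.
by rewrite /node_comb lap_comb; apply: eq_bigr => n _; rewrite lapE.
Qed.

Lemma lap_node_comb_node d n : lap (node_comb d) (val n) = d n.
Proof.
rewrite lap_node_comb (bigD1 n) //= eqxx mulr1 big1 ?addr0 // => m.
by rewrite (inj_eq val_inj) => /negPf ->; rewrite mulr0.
Qed.

Lemma lap_node_comb_nonnode d v : v \notin nodes G -> lap (node_comb d) v = 0.
Proof.
move=> vn; rewrite lap_node_comb big1 // => n _.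
by case: eqP => [nv|]; rewrite ?mulr0 //; move: vn; rewrite -nv (valP n).
Qed.

Lemma Nlin_node_comb d n : Nlin (fun m => node_comb d (val m)) n = d n.
Proof.
by rewrite -Nlin_harmonic ?lap_node_comb_node // => v; exact: lap_node_comb_nonnode.
Qed.

(** By Nlin_node_comb the square system Nlin is surjective. *)
Lemma Nlin_inj (x : node G -> F) : (forall n, Nlin x n = 0) -> forall n, x n = 0.
Proof.
move=> x0; apply: (@square_surj_inj _ _ Nlin_mx) => [d|n]; last by rewrite Nlin_mxE.
by exists (fun m => node_comb d (val m)) => n; rewrite Nlin_mxE Nlin_node_comb.
Qed.

Lemma node_comb_Nlin (x : node G -> F) n : node_comb (Nlin x) (val n) = x n.
Proof.
apply/eqP; rewrite -subr_eq0; apply/eqP; move: n; apply: Nlin_inj => n.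
by rewrite NlinB Nlin_node_comb subrr.
Qed.

End Field.
End NodeEquation.

(** * Sources of a reduced lift *)

Section LapAdditive.
Variables (G : plumbing_graph) (F : numFieldType).

(** Declared additive, so that the general lemmas on sums apply to sources. *)
Definition lapf (v : G) (z : {ffun G -> F}) : F := lap z v.

Lemma lapf_zmod_morphism v : zmod_morphism (lapf v).
Proof.
move=> x y; rewrite /lapf -lapB; apply: lap_eq => w.
by rewrite !ffunE.
Qed.

HB.instance Definition _ v :=
  GRing.isZmodMorphism.Build _ _ (lapf v) (lapf_zmod_morphism v).
End LapAdditive.

Section Lift.
Variable G : plumbing_graph.
Hypothesis G_tree : is_tree G.
Hypothesis G_negdef : negative_definite G.
Hypothesis G_min : minimal_good G.
Variable lt : rel (node G).
Hypothesis lt_order : orders_nbr_nodes lt.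
Implicit Types (u v w x y t : G) (p q : seq G) (n m : node G) (a : reduced_lift G).

Definition edge_coef a v : int :=
  \sum_n \sum_(m in nbr_nodes n | lt n m)
    (step (val n) (val m) == v)%:R * lift_edge a n m.

(** The coefficient of E_v^* in a reduced lift; when two neighbouring nodes are
    adjacent, the edge coefficient is added to that of the second one. *)
Definition lift_coef a v : int :=
  \sum_n (val n == v)%:R * lift_node a n
  + (v \in ends G)%:R * lift_end a v + edge_coef a v.

Lemma lap_lift_elt a v : lap (lift_elt lt a) v = (lift_coef a v)%:~R.
Proof.
rewrite -[LHS]/(lapf v _) /lift_elt !raddfD !raddf_sum /=.
have lapfE w k : lapf v (Estar w *~ k) = ((w == v)%:R * k)%:~R.
  rewrite raddfMz /= /lapf (lap_Estar G_tree G_negdef) -mulrzr intrM.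
  by case: (w == v).
rewrite /lift_coef /edge_coef; congr (_ + _ + _).
- by apply: eq_bigr => n _; rewrite lapfE.
- rewrite big_mkcond (bigD1 v) //= big1 ?addr0.
    by rewrite lapfE eqxx; case: (v \in _); rewrite ?mul1r ?mul0r.
  by move=> u /negPf uv; rewrite lapfE uv mul0r; case: ifP.
- apply: eq_bigr => n _; rewrite raddf_sum rmorph_sum /=.
  by apply: eq_bigr => m _; rewrite lapfE.
Qed.

Lemma chain_suffix x q1 q2 t : chain x (q1 ++ q2) t -> chain (last x q1) q2 t.
Proof.
elim: q1 x => [|y q1 IH] x //=.
by rewrite chain_cons => /and4P[_ _ _ /IH].
Qed.

(** An interior vertex of a chain is adjacent only to the two vertices next to it
    on the chain, so it can be the first vertex only of that chain and of its
    reverse.  Hence each edge coefficient belongs to a single chain. *)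
Lemma chain_first_step x q t x' q' t' v :
  chain x q t -> chain x' q' t' ->
  valency x != 2%N -> valency t != 2%N -> valency x' != 2%N -> valency t' != 2%N ->
  v \in q -> head t' q' = v -> (x' = x /\ t' = t) \/ (x' = t /\ t' = x).
Proof.
move=> C C' vx vt vx' vt' vq hv.
case/splitPr: vq C => q1 q2 C.
have [v2 vprev vnext nxy _] := chain_prev_next G_tree (chain_suffix C).
have evx' : adj v x' by rewrite (adjC G_tree) -hv (chain_step G_tree C').
have : (x' == last x q1) || (x' == head t q2).
  by rewrite -(valency2_adj x' v2 vprev vnext nxy).
case/orP => /eqP x'E.
- left; have q10 : q1 = [::].
    case/lastP: q1 {nxy vprev} x'E C => [|q1 z] //; rewrite last_rcons => xz C.
    by move: vx'; rewrite xz (chain_val2 C) // mem_cat mem_rcons inE eqxx.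
  rewrite q10 /= in x'E C; rewrite x'E in C' *; split=> //.
  by have [|_ ->] := chain_inj G_tree C C' vt vt'.
- right; have q20 : q2 = [::].
    case: q2 {nxy vnext} x'E C => [|z q2] // /= xz C.
    by move: vx'; rewrite xz (chain_val2 C) // mem_cat !inE eqxx !orbT.
  rewrite q20 /= in x'E C; rewrite x'E in C' *; split=> //.
  have := chain_rev G_tree C; rewrite rev_cat /= => Cr.
  by have [|_ ->] := chain_inj G_tree Cr C' vx vt'.
Qed.

Lemma edge_coef0 a v :
  (forall n m, m \in nbr_nodes n -> lt n m -> step (val n) (val m) != v) ->
  edge_coef a v = 0.
Proof.
move=> H; rewrite /edge_coef big1 // => n _; rewrite big1 // => m /andP[nm ltnm].
by rewrite (negPf (H n m nm ltnm)) mul0r.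
Qed.

Lemma edge_coef1 a n m v : m \in nbr_nodes n -> lt n m ->
  (forall n' m', m' \in nbr_nodes n' -> lt n' m' -> step (val n') (val m') = v ->
    n' = n /\ m' = m) ->
  edge_coef a v = (step (val n) (val m) == v)%:R * lift_edge a n m.
Proof.
move=> nm ltnm H; rewrite /edge_coef pair_big_dep /= (bigD1 (n, m)) /= ?nm //.
rewrite big1 ?addr0 // => -[n' m'] /= /andP[/andP[nm' lt'] neq].
case: eqP => [/(H _ _ nm' lt')[nn mm]|_]; last by rewrite mul0r.
by move: neq; rewrite nn mm eqxx.
Qed.

Lemma edge_coef_inner a n m v : m \in nbr_nodes n -> lt n m -> v \in inner n m ->
  edge_coef a v = (step (val n) (val m) == v)%:R * lift_edge a n m.
Proof.
move=> nm ltnm vi; apply: edge_coef1 => // n' m' nm' lt' sv.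
have C := innerP G_tree nm; have C' := innerP G_tree nm'.
have hv : head (val m') (inner n' m') = v by rewrite -(chain_stepE G_tree C').
have := chain_first_step C C' (node_val2F n) (node_val2F m) (node_val2F n')
  (node_val2F m') vi hv.
case=> -[/val_inj nn /val_inj mm] //.
by move: lt'; rewrite nn mm lt_order ?ltnm // (nbr_nodes_sym G_tree).
Qed.

Lemma edge_coef_leg a n u v : u \in nbr_ends n -> v \in tpath (val n) u ->
  edge_coef a v = 0.
Proof.
move=> nu vi; apply: edge_coef0 => n' m' nm' lt'; apply/eqP => sv.
have [q C E] := legP G_tree nu; have eu := nbr_ends_end G_tree nu.
have C' := innerP G_tree nm'.
have hv : head (val m') (inner n' m') = v by rewrite -(chain_stepE G_tree C').
move: vi; rewrite E mem_rcons inE => /orP[/eqP vu|vq].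
  move: hv; rewrite vu; case: (inner n' m') C' => [|y r] C' /= yu.
    by have := ends_nonnode eu; rewrite -yu (valP m').
  by have := end_val2F eu; rewrite -yu (chain_val2 C') ?mem_head.
have [] := chain_first_step C C' (node_val2F n) (end_val2F eu) (node_val2F n')
  (node_val2F m') vq hv.
- by case=> _ mu; have := ends_nonnode eu; rewrite -mu (valP m').
- by case=> nu' _; have := ends_nonnode eu; rewrite -nu' (valP n').
Qed.

Lemma edge_coef_node a n :
  edge_coef a (val n) = \sum_(m in nbr_nodes n | lt m n)
    (inner m n == [::])%:R * lift_edge a m n.
Proof.
rewrite /edge_coef [RHS]big_mkcond; apply: eq_bigr => m _ /=.
have stepE m' : m' \in nbr_nodes m ->
    (step (val m) (val m') == val n) = (m' == n) && (inner m n == [::]).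
  move=> mm'; have C := innerP G_tree mm'; rewrite (chain_stepE G_tree C).
  have [<-|nm'] /= := eqVneq m' n.
    case: (inner m m') C => [|y q] C /=; first by rewrite !eqxx.
    by apply/eqP => ym; have := node_val2F m'; rewrite /= -ym (chain_val2 C) ?mem_head.
  case: (inner m m') C => [|y q] C /=; first by rewrite (inj_eq val_inj) (negPf nm').
  by apply/eqP => ym; have := node_val2F n; rewrite /= -ym (chain_val2 C) ?mem_head.
have [/andP[nm ltmn]|H] := ifP.
  rewrite (bigD1 n) /=; last by rewrite (nbr_nodes_sym G_tree) nm.
  rewrite stepE ?eqxx /= ?(nbr_nodes_sym G_tree m) // big1 ?addr0 // => m'.
  by case/andP=> /andP[mm' _] /negPf nm'; rewrite stepE // nm' mul0r.
rewrite big1 // => m' /andP[mm' lt']; rewrite stepE //.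
case: eqP => [mn|_]; last by rewrite mul0r.
by move: H; rewrite (nbr_nodes_sym G_tree) -mn mm' lt'.
Qed.

Lemma lift_coef_node a n :
  lift_coef a (val n) = lift_node a n + \sum_(m in nbr_nodes n | lt m n)
    (inner m n == [::])%:R * lift_edge a m n.
Proof.
rewrite /lift_coef edge_coef_node; congr (_ + _).
rewrite (bigD1 n) //= eqxx mul1r big1 ?addr0; last first.
  by move=> m /negPf nm; rewrite (inj_eq val_inj) nm mul0r.
case: (boolP (val n \in ends G)) => [/ends_nonnode|_]; last by rewrite mul0r addr0.
by rewrite (valP n).
Qed.

Lemma lift_coef_nonnode a v : v \notin nodes G ->
  lift_coef a v = (v \in ends G)%:R * lift_end a v + edge_coef a v.
Proof.
move=> vn; rewrite /lift_coef big1 ?add0r // => n _.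
by case: eqP => [nv|]; rewrite ?mul0r //; move: vn; rewrite -nv (valP n).
Qed.

Lemma lift_coef_inner a n m v : m \in nbr_nodes n -> lt n m -> v \in inner n m ->
  lift_coef a v = (step (val n) (val m) == v)%:R * lift_edge a n m.
Proof.
move=> nm ltnm vi; rewrite lift_coef_nonnode ?(inner_nonnode G_tree nm vi) //.
rewrite (edge_coef_inner a nm ltnm vi).
case: (boolP (v \in ends G)) => [/ends_val1|_]; last by rewrite mul0r add0r.
by rewrite (chain_val2 (innerP G_tree nm) vi).
Qed.

Lemma lift_coef_leg a n u v : u \in nbr_ends n -> v \in tpath (val n) u ->
  lift_coef a v = (v == u)%:R * lift_end a u.
Proof.
move=> nu vi; rewrite lift_coef_nonnode ?(leg_nonnode G_tree nu vi) //.
rewrite (edge_coef_leg a nu vi) addr0.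
have [q C E] := legP G_tree nu; have eu := nbr_ends_end G_tree nu.
have [->|vu] := eqVneq v u; first by rewrite eu.
have vq : v \in q by move: vi; rewrite E mem_rcons inE (negPf vu).
case: (boolP (v \in ends G)) => [/ends_val1|_]; last by rewrite !mul0r.
by rewrite (chain_val2 C vq).
Qed.

Section Source.
Variable F : numFieldType.
Local Notation lc a := (fun v => (lift_coef a v)%:~R : F).

(** For n < m the only source on the chain is next to n, hence farthest from m,
    and gets the weight omega; seen from m it is the last one and gets the weight 1
    in src_inner_gt. *)
Lemma src_inner_lt a n m : m \in nbr_nodes n -> lt n m ->
  src (lc a) (inner n m) = (omega n m * lift_edge a n m)%:~R.
Proof.
move=> nm ltnm; rewrite (omega_inner G_tree nm).
have C := innerP G_tree nm; have := lift_coef_inner a nm ltnm.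
rewrite (chain_stepE G_tree C).
have := chain_uniq C; rewrite rcons_uniq => /andP[_].
case: (inner n m) => [|v p]; first by rewrite /= mul0r.
move=> /= /andP[vp Up] H; rewrite H ?mem_head // eqxx mul1r intrM src0 ?addr0 //.
move=> w wp; rewrite H ?inE ?wp ?orbT // (_ : (v == w) = false) ?mul0r //.
by apply/eqP => vw; move: vp; rewrite vw wp.
Qed.

Lemma src_inner_gt a n m : m \in nbr_nodes n -> lt m n ->
  src (lc a) (inner n m) = ((inner n m != [::])%:R * lift_edge a m n)%:~R.
Proof.
move=> nm ltmn; have mn : n \in nbr_nodes m by rewrite (nbr_nodes_sym G_tree).
have C := innerP G_tree mn; have := lift_coef_inner a mn ltmn.
rewrite (inner_sym G_tree mn) (chain_stepE G_tree C).
have := chain_uniq C; rewrite rcons_uniq => /andP[_].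
case: (inner m n) => [|v p]; first by rewrite /= mul0r.
move=> Up H; rewrite rev_cons src_last ?H ?mem_head // ?eqxx /=.
- by case: (rev p).
- by rewrite -rev_cons rev_uniq.
move=> w; rewrite mem_rev => wp; rewrite H ?inE ?wp ?orbT //.
rewrite (_ : (v == w) = false) ?mul0r //.
by apply/eqP => vw; move: Up; rewrite /= vw wp.
Qed.

Lemma src_leg_end (d : G -> F) n u : u \in nbr_ends n ->
  (forall v, v \in tpath (val n) u -> v != u -> d v = 0) ->
  src d (tpath (val n) u) = d u.
Proof.
move=> nu H; have [q C E] := legP G_tree nu.
rewrite E src_last ?(chain_uniq C) // => v vq; apply: H.
  by rewrite E mem_rcons inE vq orbT.
apply/eqP => vu; have := end_val2F (nbr_ends_end G_tree nu).
by rewrite -vu (chain_val2 C vq).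
Qed.

Lemma src_leg_lift a n u : u \in nbr_ends n ->
  src (lc a) (tpath (val n) u) = (lift_end a u)%:~R.
Proof.
move=> nu; have [q C E] := legP G_tree nu.
rewrite src_leg_end // => [|v vp /negPf vu].
  by rewrite (lift_coef_leg a nu) ?eqxx ?mul1r // E mem_rcons inE eqxx.
by rewrite (lift_coef_leg a nu) // vu mul0r.
Qed.

End Source.

(** This is node_eq for the reduced lift itself: the constants in N_a are the
    contributions of the coefficients of a.  For adjacent nodes n < m the edge
    coefficient is a source at m, and not on the chain, which accounts for the
    emptiness tests of lift_coef_node and src_inner_gt. *)
Lemma NbarE a (l : {ffun node G -> int}) n :
  Nbar lt a l n = Nlin (fun m => (l m)%:~R + cvec lt a m) n.
Proof.
rewrite NlinD; have := node_eq G_tree G_min (lift_elt lt a) n.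
rewrite lap_lift_elt lift_coef_node.
have -> : Nlin (fun m => lift_elt lt a (val m)) n = Nlin (cvec lt a) n.
  by apply: eq_Nlin => m; rewrite [RHS]ffunE.
set S1 := \sum_(m in _ ) src _ _ / _; set S2 := \sum_(u in _) src _ _ / _.
move=> eqn.
have {eqn}-> : Nlin (cvec lt a) n = (lift_node a n)%:~R
   + ((\sum_(m in nbr_nodes n | lt m n)
       (inner m n == [::])%:R * lift_edge a m n)%:~R + S1) + S2.
  move: eqn; rewrite intrD; move: (Nlin _ _) (_ %:~R) (_ %:~R) => N x y.
  by move=> eqn; rewrite addrA eqn addrAC !subrK.
have -> : S2 = \sum_(u in nbr_ends n) (lift_end a u)%:~R / (alpha_end n u)%:~R.
  apply: eq_bigr => u nu; rewrite -(src_leg_lift _ a nu); congr (_ / _).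
  by apply: src_eq => v _; rewrite lap_lift_elt.
have -> : (\sum_(m in nbr_nodes n | lt m n)
       (inner m n == [::])%:R * lift_edge a m n)%:~R + S1 =
    \sum_(m in nbr_nodes n | lt n m)
      (omega n m)%:~R / (alpha n m)%:~R * (lift_edge a n m)%:~R
    + \sum_(m in nbr_nodes n | lt m n)
      1 / (alpha n m)%:~R * (lift_edge a m n)%:~R.
  rewrite /S1 [X in _ + X = _](bigID (lt n)) /= addrCA; congr (_ + _).
    apply: eq_bigr => m /andP[nm ltnm].
    rewrite (src_eq (d' := fun v => (lift_coef a v)%:~R)); last first.
      by move=> v _; rewrite lap_lift_elt.
    by rewrite src_inner_lt // intrM mulrAC.
  rewrite rmorph_sum /= [X in _ + X = _](eq_bigl (fun m => (m \in nbr_nodes n) && lt m n)) => [|m].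
    rewrite -big_split; apply: eq_bigr => m /andP[nm ltmn] /=.
    rewrite (src_eq (d' := fun v => (lift_coef a v)%:~R)); last first.
      by move=> v _; rewrite lap_lift_elt.
    rewrite src_inner_gt // (alpha_inner G_tree nm) (inner_sym G_tree nm).
    case: (inner n m) => [|v p]; first by rewrite /= !mul1r !mul0r addr0.
    rewrite -(size_eq0 (rev _)) size_rev /= mul0r add0r !mul1r mulrC.
    by [].
  by have [nm|//] := boolP (m \in _); rewrite /= (lt_order nm) negbK.
rewrite /Nbar /Na /Nlin.
set B := \sum_(u in _) (lift_end a u)%:~R / _.
set P1 := \sum_(m in nbr_nodes n | lt n m) _.
set P2 := \sum_(m in nbr_nodes n | lt m n) _.
set Q1 := \sum_(u in _) (_)%:~R; set Q2 := \sum_(u in _) (_ - _).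
have -> : Q2 = B - (\sum_(u in nbr_ends n) (omega_end n u)%:~R / (alpha_end n u)%:~R) * (l n)%:~R - Q1.
  rewrite mulr_suml -!sumrB; apply: eq_bigr => u _; rewrite /end_arg.
  by rewrite intrB intrM; ring.
ring.
Qed.

(** For a vector without sources at the vertices of valency 2, only the ends
    contribute to node_eq. *)
Lemma node_source (y : G -> rat) n :
  (forall v, valency v = 2%N -> lap y v = 0) ->
  lap y (val n) = Nlin (fun m => y (val m)) n
    - \sum_(u in nbr_ends n) lap y u / (alpha_end n u)%:~R.
Proof.
move=> H; rewrite (node_eq G_tree G_min) [X in _ - X - _]big1 ?subr0 => [|m nm].
  congr (_ - _); apply: eq_bigr => u nu; rewrite src_leg_end // => v vi vu.
  have [q C E] := legP G_tree nu; apply/H/(chain_val2 C).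
  by move: vi; rewrite E mem_rcons inE (negPf vu).
rewrite src0 ?mul0r // => v vi; apply/H/(chain_val2 (innerP G_tree nm) vi).
Qed.

End Lift.

(** * Coefficients of powers of 1 - X *)

Section Binomial.

(** The coefficient of X^x in (1 - X)^d, for all integers x. *)
Definition zbinom (d x : int) : int := if x is Posz k then binom_coef d k else 0.

Lemma zbinom_lt0 d x : x < 0 -> zbinom d x = 0.
Proof. by case: x. Qed.

Lemma zbinom_pascal d x : zbinom d x = zbinom (d - 1) x - zbinom (d - 1) (x - 1).
Proof.
case: x => [[|k]|k].
- rewrite sub0r [zbinom _ (- 1)]zbinom_lt0 // subr0.
  by case: d => [[|m]|m]; rewrite /= ?subn1 /= ?bin0 ?addn0 ?bin0 ?expr0.
- rewrite (_ : k.+1%:Z - 1 = k); last by rewrite -addn1 PoszD addrK.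
  case: d => [[|m]|m].
  + by rewrite /= !add0n !binn bin0n mulr0 subrr.
  + rewrite (_ : m.+1%:Z - 1 = m); last by rewrite -addn1 PoszD addrK.
    by rewrite /= binS PoszD exprS; ring.
  + rewrite (_ : Negz m - 1 = Negz m.+1); last by rewrite !NegzE; lia.
    by rewrite /= !addSn !addnS [in RHS]binS PoszD; ring.
- by rewrite !zbinom_lt0 ?subr0 // !NegzE; lia.
Qed.

Lemma sum_zbinom_lt d x M :
  \sum_(j < M) zbinom d (x - j%:Z) = zbinom (d - 1) x - zbinom (d - 1) (x - M%:Z).
Proof.
elim: M => [|M IH]; first by rewrite big_ord0 subr0 subrr.
rewrite big_ord_recr /= IH [zbinom d _]zbinom_pascal.
by rewrite (_ : x - M.+1%:Z = x - M%:Z - 1); [ring | lia].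
Qed.

(** Multiplication by 1 / (1 - X). *)
Lemma sum_zbinom1 d x B : x <= B%:Z -> \sum_(j < B.+1) zbinom d (x - j%:Z) = zbinom (d - 1) x.
Proof.
by move=> xB; rewrite sum_zbinom_lt [zbinom _ (_ - _)]zbinom_lt0 ?subr0 //; lia.
Qed.

Lemma zbinomN1 x : zbinom (-1) x = (0 <= x)%R%:R.
Proof. by case: x => k //=; rewrite add0n binn. Qed.

Lemma zbinomS (d : nat) x : zbinom d x = \sum_(k < d.+1) ((-1) ^+ k * 'C(d, k)%:Z) * (x == k)%:R.
Proof.
case: x => k; last first.
  by rewrite zbinom_lt0 // big1 // => i _; rewrite mulr0.
have [kd|dk] := leqP k d.
  rewrite (bigD1 (Ordinal (kd : (k < d.+1)%N))) //= eqxx mulr1 big1 ?addr0 // => i.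
  by rewrite -val_eqE /= eq_sym eqz_nat => /negPf ->; rewrite mulr0.
rewrite /= bin_small // mulr0 big1 // => i _; rewrite eqz_nat.
by case: eqP => [ki|]; rewrite ?mulr0 //; move: (ltn_ord i) dk; rewrite -ki ltnS leqNgt => /negP.
Qed.

(** Each index i in U multiplies the series attached to own i by 1 / (1 - X);
    truncating the geometric series at the degree B is harmless, as B bounds the
    degrees N j. *)
Lemma sum_zbinom_prod (I J : finType) (own : I -> J) (d : J -> int) (B : nat)
    (U : {set I}) (N : J -> int) :
  (forall j, N j <= B%:Z) ->
  \sum_(y : {ffun I -> 'I_B.+1} | [forall i, (i \notin U) ==> (y i == ord0)])
    \prod_j zbinom (d j) (N j - \sum_(i in U | own i == j) (y i : nat)%:Z) =
  \prod_j zbinom (d j - #|[set i in U | own i == j]|%:Z) (N j).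
Proof.
have [k] := ubnP #|U|; elim: k U N => // k IH U N leU NB.
have [->|[i0 i0U]] := set_0Vmem U.
  rewrite (big_pred1 [ffun => ord0]) => [|y].
    apply: eq_bigr => j _; rewrite big1 ?subr0 => [|i]; last by rewrite inE.
    rewrite (_ : #|_| = 0%N) ?subr0 //.
    by apply: eq_card0 => i; rewrite !inE.
  apply/forallP/eqP => [H|-> i]; last by rewrite ffunE eqxx implybT.
  by apply/ffunP => i; rewrite ffunE; have := H i; rewrite inE => /eqP.
(* Split off the value at i0. *)
pose ext (ky : 'I_B.+1 * {ffun I -> 'I_B.+1}) :=
  [ffun i => if i == i0 then ky.1 else ky.2 i].
pose rst (y : {ffun I -> 'I_B.+1}) :=
  (y i0, [ffun i => if i == i0 then ord0 else y i]).
rewrite (reindex_onto ext rst) => [|y _]; last first.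
  by apply/ffunP => i; rewrite !ffunE /=; case: eqP => [->|]; rewrite ?ffunE.
set U' := U :\ i0.
pose Nk (m : 'I_B.+1) j := N j - (own i0 == j)%:R * (m : nat)%:Z.
have cardU j : #|[set i in U | own i == j]| =
    ((own i0 == j) + #|[set i in U' | own i == j]|)%N.
  by rewrite (cardsD1 i0) !inE i0U /=; congr (_ + #|pred_of_set _|)%N;
    apply/setP => i; rewrite !inE; case: (i == i0); rewrite ?andbF.
transitivity (\sum_m \sum_(y : {ffun I -> 'I_B.+1} | [forall i, (i \notin U') ==> (y i == ord0)])
    \prod_j zbinom (d j) (Nk m j - \sum_(i in U' | own i == j) (y i : nat)%:Z)).
  rewrite pair_big /=; apply: eq_big => [[m y]|[m y] _] /=.
    apply/andP/forallP => [[/forallP H /eqP[_ yE]] i|H].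
      rewrite -yE !inE !ffunE negb_and negbK; case: eqVneq => //= ne.
      by have := H i; rewrite ffunE /= (negPf ne).
    split.
      apply/forallP => i; rewrite ffunE /=; case: (eqVneq i i0) => [->|ii]; first by rewrite i0U.
      by have := H i; rewrite !inE ii.
    rewrite /rst /ext /= ffunE eqxx; apply/eqP; congr (_, _).
    apply/ffunP => i; rewrite !ffunE; case: eqP => // ->.
    by have := H i0; rewrite !inE eqxx => /eqP.
  apply: eq_bigr => j _; congr zbinom; rewrite /Nk -addrA -opprD; congr (_ - _).
  have [oj|noj] := eqVneq (own i0) j.
    rewrite (bigD1 i0) /=; last by rewrite i0U oj eqxx.
    rewrite ffunE eqxx mul1r; congr (_ + _).
    apply: eq_big => [i|i /andP[_ /negPf ii]]; last by rewrite ffunE ii.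
    by rewrite !inE andbC andbA.
  rewrite mul0r add0r; apply: eq_big => [i|i /andP[_ oi]].
    by rewrite !inE; case: (eqVneq i i0) => //= ->; rewrite (negPf noj) andbF.
  by rewrite ffunE; case: (eqVneq i i0) => // ii; move: noj; rewrite -ii oi.
have NkB m j : Nk m j <= B%:Z.
  by apply: le_trans (NB j); rewrite /Nk gerBl; case: (own i0 == j); rewrite ?mul1r ?mul0r.
have ltU : (#|U'| < k)%N by move: leU; rewrite (cardsD1 i0) i0U.
pose d' j := d j - #|[set i in U' | own i == j]|%:Z.
have summandE m : \sum_(y : {ffun I -> 'I_B.+1} | [forall i, (i \notin U') ==> (y i == ord0)])
      \prod_j zbinom (d j) (Nk m j - \sum_(i in U' | own i == j) (y i : nat)%:Z) =
    zbinom (d' (own i0)) (N (own i0) - m%:Z) *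
      \prod_(j | j != own i0) zbinom (d' j) (N j).
  rewrite (IH U' (Nk m)) // (bigD1 (own i0)) //= {1}/Nk eqxx mul1r; congr (_ * _).
  apply: eq_bigr => j nj; congr zbinom.
  by rewrite /Nk eq_sym (negPf nj) mul0r subr0.
rewrite (eq_bigr _ (fun m _ => summandE m)).
rewrite -mulr_suml sum_zbinom1 // [RHS](bigD1 (own i0)) //=; congr (_ * _).
  by congr zbinom; rewrite cardU eqxx /d' add1n -addn1 PoszD opprD addrA.
by apply: eq_bigr => j nj; rewrite /d' cardU eq_sym (negPf nj) add0n.
Qed.

End Binomial.

(** * Coefficients of the Poincare series *)

Section Taylor.
Variables (I : finType) (E : zmodType) (g : I -> E) (d : I -> int) (e : E).

Lemma taylor_eq0 :
  (forall x : {ffun I -> nat}, \sum_i g i *+ x i = e ->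
     \prod_i binom_coef (d i) (x i) = 0) ->
  taylor g d e = 0.
Proof. by move=> H; apply: fsbig1 => x /= /H. Qed.

Lemma taylor_eq (x0 : {ffun I -> nat}) :
  \sum_i g i *+ x0 i = e ->
  (forall x : {ffun I -> nat}, \sum_i g i *+ x i = e -> x = x0) ->
  taylor g d e = \prod_i binom_coef (d i) (x0 i).
Proof.
move=> ex0 H; rewrite /taylor.
have -> : [set x : {ffun I -> nat} | \sum_i g i *+ x i = e]%classic = [set x0]%classic.
  by apply/seteqP; split=> [x /= /H //|x /= ->].
exact: fsbig_set1.
Qed.
End Taylor.

Section LatClass.
Variable V : finType.
Implicit Types x y : {ffun V -> rat}.

Lemma lat_classP x y : lat_class x = lat_class y <-> forall v, (x v - y v) \is a Num.int.
Proof.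
have E : (lat_class x == lat_class y) = (x - y \in int_lattice V).
  by rewrite Quotient.idealrBE.
split=> [/eqP|H]; last apply/eqP; rewrite E inE.
  by move=> /forallP H v; have := H v; rewrite !ffunE.
by apply/forallP => v; rewrite !ffunE.
Qed.

Lemma lat_classD x y : lat_class (x + y) = lat_class x + lat_class y.
Proof. by rewrite /lat_class /lat_quot raddfD. Qed.

Lemma lat_classMn x k : lat_class (x *+ k) = lat_class x *+ k.
Proof. by rewrite /lat_class /lat_quot raddfMn. Qed.

Lemma lat_class0 : lat_class (0 : {ffun V -> rat}) = 0.
Proof. by rewrite /lat_class /lat_quot raddf0. Qed.

End LatClass.

Section ZhValue.
Variable G : plumbing_graph.
Hypothesis G_tree : is_tree G.
Hypothesis G_negdef : negative_definite G.
Implicit Types (u v w : G) (l : {ffun G -> rat}) (k : {ffun G -> nat}).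

Lemma lap_ext l l' : (forall v, lap l v = lap l' v) -> l = l'.
Proof.
move=> H; apply/ffunP => v; apply/eqP; rewrite -subr_eq0; apply/eqP.
have := @lap_inj _ G_tree G_negdef (fun v => l v - l' v); apply=> w.
by rewrite lapB H subrr.
Qed.

Lemma Estar_comb l k : \sum_v Estar v *+ k v = l <-> forall v, lap l v = (k v)%:R.
Proof.
have E v : lap (\sum_v Estar v *+ k v : {ffun G -> rat}) v = (k v)%:R.
  rewrite -[LHS]/(lapf v _) raddf_sum /= (bigD1 v) //= big1 => [|w wv].
    by rewrite raddfMn /= /lapf (lap_Estar G_tree G_negdef) eqxx addr0.
  by rewrite raddfMn /= /lapf (lap_Estar G_tree G_negdef) (negPf wv) mul0rn.
split=> [<-//|H]; apply: lap_ext => v; by rewrite E H.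
Qed.

Lemma pair_comb k :
  \sum_v (lat_class (Estar v), Estar v) *+ k v =
  (lat_class (\sum_v Estar v *+ k v), \sum_v Estar v *+ k v).
Proof.
apply: (big_rec2 (fun x y => x = (lat_class y, y))) => [|v y x _ ->].
  by rewrite lat_class0.
rewrite lat_classD lat_classMn.
by elim: (k v) => [|j IH]; rewrite ?mulr0n ?add0r // !mulrS -!addrA IH.
Qed.

(** A vector is the combination of the E_v^* with its sources as coefficients, so at
    most one monomial contributes; a negative source makes both sides vanish. *)
Lemma Zh_eq (h : lat_quot G) l (k : G -> int) :
  lat_class l = h -> (forall v, lap l v = (k v)%:~R) ->
  Zh h l = \prod_v zbinom ((valency v)%:Z - 2) (k v).
Proof.
move=> lh lk; rewrite /Zh /ZH.
have [kpos|] := boolP [forall v, 0 <= k v].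
  have kE v : k v = (`|k v|%N)%:Z by rewrite gez0_abs ?(forallP kpos).
  rewrite (@taylor_eq _ _ _ _ _ [ffun v => `|k v|%N]).
  - by apply: eq_bigr => v _; rewrite ffunE [in RHS]kE.
  - rewrite pair_comb; suff -> : \sum_v Estar v *+ [ffun v => `|k v|%N] v = l by rewrite lh.
    by apply/Estar_comb => v; rewrite ffunE lk [in LHS]kE.
  move=> x; rewrite pair_comb => -[_ /Estar_comb H]; apply/ffunP => v.
  rewrite ffunE; apply/eqP; rewrite -(eqr_nat rat) -H lk {1}kE; exact: eqxx.
case/forallPn => v; rewrite -ltNge => kv.
rewrite [RHS](bigD1 v) //= zbinom_lt0 // mul0r; apply: taylor_eq0 => x.
rewrite pair_comb => -[_ /Estar_comb/(_ v)]; rewrite lk => E.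
by move: kv; rewrite -(ltr_int rat) E ltNge ler0n.
Qed.

(** At valency 2 the factor of f_H is constant, so only k v = 0 contributes. *)
Lemma Zh_neq0 (h : lat_quot G) l : Zh h l != 0 ->
  lat_class l = h /\ exists k : {ffun G -> nat},
    (forall v, lap l v = (k v)%:R) /\ (forall v, valency v = 2%N -> k v = 0%N).
Proof.
move=> Z; have : ~ forall x : {ffun G -> nat},
    \sum_v (lat_class (Estar v), Estar v) *+ x v = (h, l) ->
     \prod_v binom_coef ((valency v)%:Z - 2) (x v) = 0.
  by move=> H; move/eqP: Z; apply; apply: taylor_eq0.
move/existsNP => [k] /not_implyP[]; rewrite pair_comb => -[lh lE] /eqP P.
move: lh; rewrite lE => lh; split=> //; exists k; split; first exact/Estar_comb.
move=> v v2; apply/eqP; apply: contraNT P; rewrite -lt0n => kv.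
rewrite (bigD1 v) //= v2 subrr /= bin_small // mulr0 mul0r; exact: eqxx.
Qed.

End ZhValue.

(** * Vectors with given node coordinates *)

Section Counting.
Variable G : plumbing_graph.
Hypothesis G_tree : is_tree G.
Hypothesis G_negdef : negative_definite G.
Hypothesis G_min : minimal_good G.
Hypothesis G_nodes : nodes G != finset.set0.
Variable lt : rel (node G).
Hypothesis lt_order : orders_nbr_nodes lt.
Variable own : G -> node G.
(* own u is the node from which the leg of the end u issues. *)
Hypothesis ownP : forall u n, u \in ends G -> (u \in nbr_ends n) = (own u == n).
Variables (a : reduced_lift G) (l : {ffun node G -> int}).
Implicit Types (u v w : G) (n m : node G) (z : G -> rat) (y : G -> int).

Lemma own_nbr n u : u \in nbr_ends n -> own u = n.
Proof.
by move=> nu; apply/eqP; rewrite -(ownP n (nbr_ends_end G_tree nu)).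
Qed.

Lemma nonnode_cases v : v \notin nodes G -> v \notin ends G -> valency v = 2%N.
Proof.
move=> vn; have /set0Pn[r rn] := G_nodes.
have : (0 < valency v)%N.
  by apply: (@valency_gt0 _ G_tree _ r); apply/eqP => vr; rewrite vr rn in vn.
by move: vn; rewrite !inE; case: (valency v) => [|[|[|]]].
Qed.

Definition arg_frac u : rat :=
  end_arg a l (own u) u - (Num.floor (end_arg a l (own u) u))%:~R.

Definition node_source_of y n : rat :=
  Na lt a l n - \sum_(u in nbr_ends n) (y u)%:~R.

(** The sources of the vector with node coordinates l + c_a attached to the integers
    y u at the ends: on the leg of u the free integer coordinate is, up to a shift,
    y u, and the source at u is nonnegative iff y u is. *)
Definition source_of y v : rat :=
  if insub v is Some n then node_source_of y n
  else if v \in ends G then (alpha_end (own v) v)%:~R * ((y v)%:~R + arg_frac v)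
  else 0.

Lemma source_of_node y n : source_of y (val n) = node_source_of y n.
Proof. by rewrite /source_of valK. Qed.

Lemma source_of_end y n u : u \in nbr_ends n ->
  source_of y u = (alpha_end n u)%:~R * ((y u)%:~R + arg_frac u).
Proof.
move=> nu; have eu := nbr_ends_end G_tree nu.
by rewrite /source_of insubF ?eu ?(own_nbr nu) //; apply/negbTE/ends_nonnode.
Qed.

Lemma source_of_val2 y v : valency v = 2%N -> source_of y v = 0.
Proof.
move=> v2; rewrite /source_of insubF; last by rewrite inE v2.
by rewrite inE v2.
Qed.

Lemma Nbar_frac n : Nbar lt a l n = Na lt a l n + \sum_(u in nbr_ends n) arg_frac u.
Proof.
by congr (_ + _); apply: eq_bigr => u nu; rewrite /arg_frac (own_nbr nu).
Qed.

Lemma alpha_end_neq0 n u : u \in nbr_ends n -> (alpha_end n u)%:~R != 0 :> rat.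
Proof. by move=> nu; rewrite intr_eq0 gt_eqF ?alpha_end_gt0. Qed.

(** With the sources of source_of outside the nodes, z has the sources of source_of
    at the nodes iff it has the node coordinates l + c_a, Nlin being injective. *)
Lemma node_defect y z n : (forall v, v \notin nodes G -> lap z v = source_of y v) ->
  lap z (val n) - node_source_of y n =
  Nlin (fun m => z (val m) - ((l m)%:~R + cvec lt a m)) n.
Proof.
move=> H; rewrite NlinB -(NbarE G_tree G_negdef G_min lt_order) Nbar_frac.
rewrite (node_source G_tree G_min) => [|v v2].
  rewrite (eq_bigr (fun u => (y u)%:~R + arg_frac u)) => [|u nu].
    by rewrite big_split /= /node_source_of; ring.
  rewrite H ?(source_of_end y nu); last exact/ends_nonnode/(nbr_ends_end G_tree nu).
  by rewrite mulrC mulKf ?alpha_end_neq0.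
by rewrite H ?source_of_val2 // inE v2.
Qed.

Section Integral.
(* z is the difference between a vector over l + c_a and the reduced lift. *)
Variable z : G -> rat.
Hypothesis z_node : forall n, z (val n) = (l n)%:~R.
Hypothesis z_val2 : forall v, valency v = 2%N -> lap z v = - (lift_coef lt a v)%:~R.

(** The chain is solved from m towards n: the lift has its source on the first
    vertex after n, where it gets the weight 1, which produces the congruence of
    Z^N(a). *)
Lemma edge_value n m : m \in nbr_nodes n -> lt n m ->
  (alpha n m)%:~R * z (step (val m) (val n)) =
  (l n + omega m n * l m - (inner m n != [::])%:R * lift_edge a n m)%:~R.
Proof.
move=> nm ltnm; have mn : n \in nbr_nodes m by rewrite (nbr_nodes_sym G_tree).
rewrite -(alpha_sym G_tree nm) (edge_eq G_tree z mn) !z_node.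
rewrite intrB intrD [in RHS]intrM; congr (_ + _).
rewrite -(src_inner_gt G_tree lt_order _ _ mn ltnm) -src_opp.
by apply: src_eq => v /(chain_val2 (innerP G_tree mn))/z_val2.
Qed.

Lemma leg_value n u : u \in nbr_ends n ->
  (alpha_end n u)%:~R * z (step (val n) u) = (omega_end n u * l n)%:~R + lap z u.
Proof.
move=> nu; rewrite (leg_eq G_tree z nu) z_node intrM; congr (_ + _).
apply: (src_leg_end G_tree nu) => v vi vu.
have [q C E] := legP G_tree nu.
have v2 : valency v = 2%N.
  by apply: (chain_val2 C); move: vi; rewrite E mem_rcons inE (negPf vu).
by rewrite z_val2 // (lift_coef_leg G_tree lt a nu vi) (negPf vu) mul0r oppr0.
Qed.

Lemma integral_ZN : (forall v, z v \is a Num.int) -> ZN lt a l.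
Proof.
move=> zint n m nm ltnm.
have mn : n \in nbr_nodes m by rewrite (nbr_nodes_sym G_tree).
have := edge_value nm ltnm; have /intrP[k ->] := zint (step (val m) (val n)).
rewrite -intrM => /intr_inj E.
apply/eqP; rewrite eqz_mod_dvd; apply/dvdzP.
have [i0|i0] := eqVneq (inner m n) [::].
  exists (l n + omega m n * l m - lift_edge a n m).
  by rewrite -(alpha_sym G_tree nm) (alpha_inner G_tree mn) i0 mulr1.
by exists k; rewrite [RHS]mulrC E i0 mul1r.
Qed.

Hypothesis l_ZN : ZN lt a l.
Variable y : G -> int.
Hypothesis z_end : forall u, u \in ends G ->
  lap z u = source_of y u - (lift_coef lt a u)%:~R.

(** The congruence makes the coordinate next to m an integer; with the coordinate at
    m it starts the recurrence, whose coefficients are integers. *)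
Lemma integral_edge n m v : m \in nbr_nodes n -> lt n m -> v \in inner m n ->
  z v \is a Num.int.
Proof.
move=> nm ltnm vi; have mn : n \in nbr_nodes m by rewrite (nbr_nodes_sym G_tree).
have C := innerP G_tree mn.
have E : head (z (val n)) (map z (inner m n)) = z (step (val m) (val n)).
  by rewrite (chain_stepE G_tree C); case: (inner m n).
have i0 : inner m n != [::] by apply/eqP => i0; move: vi; rewrite i0.
apply: (recur_int (chain_recur G_tree z C)) vi => [| |w wi].
- by rewrite z_node intr_int.
- rewrite E; have := edge_value nm ltnm.
  have /eqP := l_ZN nm ltnm; rewrite eqz_mod_dvd => /dvdzP[k kE].
  rewrite i0 mul1r kE mulrC [in RHS]intrM; move/mulIf.
  by rewrite intr_eq0 gt_eqF ?alpha_gt0 // => /(_ isT) ->; rewrite intr_int.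
by rewrite z_val2 ?rpredN ?intr_int // (chain_val2 C wi).
Qed.

Lemma leg_step n u : u \in nbr_ends n ->
  z (step (val n) u) = (y u - Num.floor (end_arg a l n u))%:~R.
Proof.
move=> nu; have eu := nbr_ends_end G_tree nu; have a0 := alpha_end_neq0 nu.
apply: (mulfI a0); rewrite leg_value // z_end // (source_of_end y nu).
have [q C E] := legP G_tree nu.
rewrite (lift_coef_leg G_tree lt a nu) ?eqxx; last by rewrite E mem_rcons mem_head.
rewrite mul1r /arg_frac (own_nbr nu) {1}/end_arg !intrB.
by move: (_ %:~R) (alpha_end _ _)%:~R a0 => w al al0; field.
Qed.

Lemma integral_leg n u v : u \in nbr_ends n -> v \in tpath (val n) u ->
  z v \is a Num.int.
Proof.
move=> nu; have eu := nbr_ends_end G_tree nu.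
have [q C E] := legP G_tree nu; rewrite E.
apply: (recur_int (leg_recur G_tree z eu C)) => [| |w].
- by rewrite z_node intr_int.
- suff -> : head 0 (map z (rcons q u)) = z (step (val n) u).
    by rewrite leg_step // intr_int.
  by rewrite (chain_stepE G_tree C); case: (q).
rewrite mem_rcons inE => /orP[/eqP->|wq]; last first.
  by rewrite z_val2 ?rpredN ?intr_int // (chain_val2 C wq).
have := leg_value nu; rewrite leg_step // => legE.
by rewrite -(addKr (omega_end n u * l n)%:~R (lap z u)) -legE -intrM rpredD ?rpredN ?intr_int.
Qed.

Lemma integral_all v : z v \is a Num.int.
Proof.
have [vn|vn] := boolP (v \in nodes G).
  by rewrite (z_node (exist _ v vn)) intr_int.
case: (cover_node_end G_tree G_nodes vn) => [[n [m [nm]]]|[n [u [nu]]]]; last first.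
  have [q C E] := legP G_tree nu.
  by rewrite (chain_ocE G_tree C) inE -E; exact: integral_leg.
rewrite (chain_ooE G_tree (innerP G_tree nm)) inE.
have mn : n \in nbr_nodes m by rewrite (nbr_nodes_sym G_tree).
have [ltnm|ltmn] := boolP (lt n m).
  by rewrite (inner_sym G_tree mn) mem_rev; exact: integral_edge.
by apply: integral_edge; rewrite // lt_order.
Qed.

End Integral.

Definition source_vec y : {ffun G -> rat} :=
  sval (cid (lap_surj G_tree G_negdef (source_of y))).

Lemma lap_source_vec y v : lap (source_vec y) v = source_of y v.
Proof. by rewrite /source_vec; case: cid. Qed.

(** The vector was defined by its sources; its node coordinates follow from
    node_defect. *)
Lemma source_vec_node y n : source_vec y (val n) = (l n)%:~R + cvec lt a n.
Proof.
apply/eqP; rewrite -subr_eq0; apply/eqP; move: n.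
apply: (Nlin_inj G_tree G_min (lap_Estar G_tree G_negdef)) => n.
rewrite -(@node_defect y) => [|v _]; last exact: lap_source_vec.
by rewrite lap_source_vec source_of_node subrr.
Qed.

Lemma piN_source_vec y : piN (source_vec y) = [ffun n => (l n)%:~R] + cvec lt a.
Proof.
apply/ffunP => n; rewrite [LHS]ffunE source_vec_node [RHS]ffunE.
by congr (_ + _); rewrite ffunE.
Qed.

Lemma source_vec_int y v : ZN lt a l -> source_vec y v - lift_elt lt a v \is a Num.int.
Proof.
move=> lZ; apply: (@integral_all (fun v => source_vec y v - lift_elt lt a v) _ _ lZ y) => [n|w w2|u eu].
- by rewrite source_vec_node [cvec lt a n]ffunE addrK.
- by rewrite lapB lap_source_vec source_of_val2 // (lap_lift_elt G_tree G_negdef) sub0r.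
- by rewrite lapB lap_source_vec (lap_lift_elt G_tree G_negdef).
Qed.

Lemma lap_int z : (forall v, z v \is a Num.int) -> forall v, lap z v \is a Num.int.
Proof.
move=> H v; rewrite /lap rpredB ?rpred_sum //.
by rewrite rpredM ?rpredN ?intr_int.
Qed.

Lemma source_of_int y v : ZN lt a l -> source_of y v \is a Num.int.
Proof.
move=> lZ; rewrite -lap_source_vec.
have /(_ v) := lap_int (fun w => source_vec_int y w lZ).
rewrite lapB (lap_lift_elt G_tree G_negdef) => H.
by rewrite -(subrK (lift_coef lt a v)%:~R (lap _ v)) rpredD ?intr_int.
Qed.

(** N_a(l, n) is the source at n of the vector attached to y = 0. *)
Lemma Na_int n : ZN lt a l -> Na lt a l n \is a Num.int.
Proof.
move=> lZ; have := source_of_int (fun=> 0) (val n) lZ.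
by rewrite source_of_node /node_source_of big1 ?subr0.
Qed.

Lemma arg_frac_bound u : 0 <= arg_frac u < 1.
Proof.
rewrite /arg_frac subr_ge0 floor_le /= ltrBlDl -[X in _ < _ + X]/(1%:~R) -intrD.
exact: floorD1_gt.
Qed.

End Counting.

(** * The series in the node variables *)

Section NodeCoefficient.
Variable G : plumbing_graph.
Hypothesis G_tree : is_tree G.
Hypothesis G_negdef : negative_definite G.
Hypothesis G_min : minimal_good G.
Hypothesis G_nodes : nodes G != finset.set0.
Variable lt : rel (node G).
Hypothesis lt_order : orders_nbr_nodes lt.
Variable own : G -> node G.
Hypothesis ownP : forall u n, u \in ends G -> (u \in nbr_ends n) = (own u == n).
Variables (a : reduced_lift G) (l : {ffun node G -> int}).
Implicit Types (u v w : G) (n m : node G) (y : G -> int).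

Local Notation source_vec := (source_vec G_tree G_negdef lt own a l).
Local Notation source_of := (source_of lt own a l).
Local Notation lap_source_vec := (lap_source_vec G_tree G_negdef lt own a l).

Lemma source_vec_class y : ZN lt a l -> lat_class (source_vec y) = lat_class (lift_elt lt a).
Proof. by move=> lZ; apply/lat_classP => v; apply: source_vec_int. Qed.

(** The ends contribute the factor 1, their sources being nonnegative. *)
Lemma Zh_source_vec y : ZN lt a l -> (forall u, 0 <= y u) ->
  Zh (lat_class (lift_elt lt a)) (source_vec y) =
  \prod_n zbinom ((valency (val n))%:Z - 2)
    (Num.floor (Na lt a l n) - \sum_(u in nbr_ends n) y u).
Proof.
move=> lZ y0.
have SI v := source_of_int G_tree G_negdef G_min G_nodes lt_order ownP y v lZ.
rewrite (Zh_eq G_tree G_negdef (k := fun v => Num.floor (source_of y v))).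
- rewrite (bigID (fun v => v \in nodes G)) /= [X in _ * X]big1 ?mulr1 => [|v vn].
    rewrite big_sub; apply: eq_bigr => n _; congr zbinom.
    rewrite source_of_node /node_source_of -rmorph_sum /=.
    have /intrP[i ->] := Na_int G_tree G_negdef G_min G_nodes lt_order ownP n lZ.
    by rewrite -intrB !intrKfloor.
  have [eu|eu] := boolP (v \in ends G); last first.
    by rewrite (source_of_val2 lt own a l y) ?(nonnode_cases G_tree G_nodes) // floor0.
  rewrite (ends_val1 eu) zbinomN1 floor_ge0.
  have nu : v \in nbr_ends (own v) by rewrite ownP.
  rewrite (source_of_end G_tree lt ownP a l y nu) mulr_ge0 //.
    by rewrite ler0z ltW ?alpha_end_gt0.
  by rewrite addr_ge0 ?ler0z //; case/andP: (arg_frac_bound own a l v).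
- exact: source_vec_class.
- by move=> v; rewrite lap_source_vec floorK.
Qed.

Lemma source_vec_inj y y' u : u \in ends G -> source_vec y = source_vec y' -> y u = y' u.
Proof.
move=> eu E; have nu : u \in nbr_ends (own u) by rewrite ownP.
have : source_of y u = source_of y' u by rewrite -!lap_source_vec E.
rewrite !(source_of_end G_tree lt ownP a l _ nu).
by move/(mulfI (alpha_end_neq0 G_tree G_min nu))/addIr/intr_inj.
Qed.

(** The integer y u is read off from the coordinate of x next to the node on the
    leg of u.  It is at least 0 because it is larger than -1, the source at u being
    nonnegative; it is bounded because the source at the node is nonnegative. *)
Lemma source_vec_surj (x : {ffun G -> rat}) (k : {ffun G -> nat}) :
  lat_class x = lat_class (lift_elt lt a) ->
  (forall v, lap x v = (k v)%:R) -> (forall v, valency v = 2%N -> k v = 0%N) ->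
  (forall n, x (val n) = (l n)%:~R + cvec lt a n) ->
  ZN lt a l /\ exists y : G -> int,
    (forall u, u \in ends G -> 0 <= y u <= Num.floor (Na lt a l (own u))) /\ x = source_vec y.
Proof.
move=> /lat_classP xint xk k2 xn.
pose z v := x v - lift_elt lt a v.
have z_node n : z (val n) = (l n)%:~R by rewrite /z xn [cvec lt a n]ffunE addrK.
have z_lap v : lap z v = (k v)%:R - (lift_coef lt a v)%:~R.
  by rewrite lapB xk (lap_lift_elt G_tree G_negdef).
have z_val2 v : valency v = 2%N -> lap z v = - (lift_coef lt a v)%:~R.
  by move=> v2; rewrite z_lap k2 // sub0r.
have lZ : ZN lt a l by apply: (integral_ZN G_tree lt_order z_node z_val2) => v; exact: (xint v).
split=> //.
have nu u : u \in ends G -> u \in nbr_ends (own u) by move=> eu; rewrite ownP.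
pose y u := Num.floor (z (step (val (own u)) u) + (Num.floor (end_arg a l (own u) u))%:~R).
have yE u : u \in ends G -> (k u)%:R = (alpha_end (own u) u)%:~R * ((y u)%:~R + arg_frac own a l u) :> rat.
  have yint : z (step (val (own u)) u) + (Num.floor (end_arg a l (own u) u))%:~R
      \is a Num.int.
    by apply: rpredD; [exact: (xint (step _ _)) | exact: intr_int].
  move=> eu; rewrite /y floorK //.
  have [q C E] := legP G_tree (nu u eu).
  have := leg_value G_tree z_node z_val2 (nu u eu); rewrite z_lap.
  rewrite (lift_coef_leg G_tree lt a (nu u eu)); last by rewrite E mem_rcons mem_head.
  have aux (r s t : rat) : r + s + (t - s) = r + t by ring.
  rewrite eqxx mul1r /arg_frac aux (mulrDr _ (z _)) => ->.
  have -> : (alpha_end (own u) u)%:~R * end_arg a l (own u) u =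
      (lift_end a u - omega_end (own u) u * l (own u))%:~R.
    by rewrite /end_arg mulrC divfK ?(alpha_end_neq0 G_tree G_min (nu u eu)).
  by rewrite intrB; ring.
have xsrc v : v \notin nodes G -> lap x v = source_of y v.
  move=> vn; have [ev|ev] := boolP (v \in ends G).
    by rewrite xk yE // (source_of_end G_tree lt ownP a l y (nu v ev)).
  have v2 := nonnode_cases G_tree G_nodes vn ev.
  by rewrite xk k2 // source_of_val2.
have xnode n : lap x (val n) = node_source_of lt a l y n.
  apply/eqP; rewrite -subr_eq0.
  rewrite (node_defect G_tree G_negdef G_min lt_order ownP n xsrc).
  rewrite (eq_Nlin (y := fun=> 0)) => [|m]; last by rewrite xn subrr.
  by rewrite /Nlin mulr0 big1 ?subr0 // => m _; rewrite mul0r.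
have y0 u : u \in ends G -> 0 <= y u.
  move=> eu; have /andP[_ f1] := arg_frac_bound own a l u.
  have al0 : 0 < (alpha_end (own u) u)%:~R :> rat by rewrite ltr0z alpha_end_gt0 ?nu.
  have : 0 <= (y u)%:~R + arg_frac own a l u.
    by rewrite -(pmulr_rge0 _ al0) -yE.
  move=> ge0; have : (-1)%:~R < (y u)%:~R :> rat by rewrite rmorphN1; lra.
  by rewrite ltr_int; lia.
exists y; split=> [u eu|].
  rewrite y0 //= floor_ge_int; have := nu u eu; move: (own u) => n un.
  have : 0 <= node_source_of lt a l y n by rewrite -xnode xk.
  rewrite /node_source_of subr_ge0; apply: le_trans.
  rewrite (bigD1 u) //= lerDl sumr_ge0 // => w /andP[nw _].
  by rewrite ler0z y0 ?(nbr_ends_end G_tree nw).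
apply: (lap_ext G_tree G_negdef) => v; rewrite lap_source_vec.
have [vn|vn] := boolP (v \in nodes G); last exact: xsrc.
by rewrite -[v]/(val (exist _ v vn : node G)) xnode source_of_node.
Qed.

End NodeCoefficient.

Section NodeSeries.
Variable G : plumbing_graph.
Hypothesis G_tree : is_tree G.
Hypothesis G_negdef : negative_definite G.
Hypothesis G_min : minimal_good G.
Hypothesis G_nodes : nodes G != finset.set0.
Variable lt : rel (node G).
Hypothesis lt_order : orders_nbr_nodes lt.
Variable a : reduced_lift G.
Implicit Types (u v w : G) (n m : node G) (l : {ffun node G -> int}).

Local Notation h := (lat_class (lift_elt lt a)).

Definition toQ (I : finType) (l : {ffun I -> int}) : {ffun I -> rat} :=
  [ffun i => (l i)%:~R].

Lemma source_vec_ext own l (y y' : G -> int) :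
  (forall u n, u \in ends G -> (u \in nbr_ends n) = (own u == n)) ->
  (forall u, u \in ends G -> y u = y' u) ->
  source_vec G_tree G_negdef lt own a l y = source_vec G_tree G_negdef lt own a l y'.
Proof.
move=> ownP yy; apply: (lap_ext G_tree G_negdef) => v.
rewrite !lap_source_vec /source_of; case: insub => [n|].
  congr (_ - _); apply: eq_bigr => u nu.
  by rewrite yy ?(nbr_ends_end G_tree nu).
by case: ifP => // ev; rewrite yy.
Qed.

(** The sum over the vectors above l + c_a becomes a sum over the integers y u at the
    ends, each of which contributes a geometric series. *)
Lemma Zh_nodes_ZN l : ZN lt a l ->
  Zh_nodes h (toQ l + cvec lt a) =
  \prod_n zbinom ((deltaN n)%:Z - 2) (Num.floor (Na lt a l n)).
Proof.
move=> lZ; have [own ownP] := owner_exists G_tree G_nodes.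
pose B := (\sum_n `|Num.floor (Na lt a l n)|)%N.
have NB n : Num.floor (Na lt a l n) <= B%:Z.
  apply: le_trans (ler_norm _) _; rewrite -abszE lez_nat.
  by rewrite /B (bigD1 n) //= leq_addr.
pose yv (y : {ffun G -> 'I_B.+1}) u : int := (y u : nat)%:Z.
pose L y := source_vec G_tree G_negdef lt own a l (yv y).
pose Y := [pred y : {ffun G -> 'I_B.+1} | [forall u, (u \notin ends G) ==> (y u == ord0)]].
have Y0 y u : y \in Y -> u \notin ends G -> y u = ord0.
  by move=> /forallP/(_ u)/implyP H /H/eqP.
have L_inj : {in Y &, injective L}.
  move=> y y' Yy Yy' E; apply/ffunP => u.
  have [eu|eu] := boolP (u \in ends G); last by rewrite !Y0.
  have : yv y u = yv y' u by apply: (source_vec_inj G_min ownP eu E).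
  by move/eqP; rewrite eqz_nat => /eqP/val_inj.
have L_in y : piN (L y) = toQ l + cvec lt a by exact: piN_source_vec.
rewrite /Zh_nodes (@fsbigE _ _ _ _ _ [seq L y | y <- enum Y]).
- rewrite big_map (eq_bigl xpredT) => [|y]; last by apply/mem_set; exact: L_in.
  rewrite big_enum /=.
  rewrite (eq_bigr (fun y : {ffun G -> 'I_B.+1} =>
    \prod_n zbinom ((valency (val n))%:Z - 2) (Num.floor (Na lt a l n)
       - \sum_(u in ends G | own u == n) (y u : nat)%:Z))) => [|y _]; last first.
    rewrite (Zh_source_vec G_tree G_negdef G_min G_nodes lt_order ownP lZ) //.
    apply: eq_bigr => n _; congr (zbinom _ (_ - _)); apply: eq_bigl => u.
    have [eu|eu] /= := boolP (u \in ends G); first exact: ownP.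
    by apply/negbTE; apply: contra eu => /(nbr_ends_end G_tree).
  rewrite (sum_zbinom_prod own _ _ NB); apply: eq_bigr => n _; congr zbinom.
  rewrite valencyE // (_ : [set i in ends G | own i == n] = nbr_ends n).
    by rewrite PoszD; ring.
  apply/setP => u; rewrite inE.
  have [eu|eu] /= := boolP (u \in ends G); first by rewrite ownP.
  by apply/esym/negbTE; apply: contra eu => /(nbr_ends_end G_tree).
- by rewrite map_inj_in_uniq ?enum_uniq // => y y'; rewrite !mem_enum; exact: L_inj.
- by move=> x /= /mapP[y _ ->]; exact: L_in.
move=> x /= xc; apply: contraNeq => /(Zh_neq0 G_tree G_negdef)[xh [k [xk k2]]].
have xn n : x (val n) = (l n)%:~R + cvec lt a n.
  by move/ffunP/(_ n): xc; rewrite ffunE [RHS]ffunE ffunE.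
have [_ [y [yB ->]]] :=
  source_vec_surj G_tree G_negdef G_min G_nodes lt_order ownP xh xk k2 xn.
apply/mapP.
exists [ffun u => if u \in ends G then inord `|y u|%N else ord0].
  rewrite mem_enum; apply/forallP => u; apply/implyP => eu.
  by rewrite ffunE (negPf eu).
apply: source_vec_ext => // u eu; rewrite /yv ffunE eu inordK.
  by have /andP[y0 _] := yB u eu; rewrite gez0_abs.
have /andP[y0 y1] := yB u eu.
by have := le_trans y1 (NB (own u)); rewrite ltnS -lez_nat gez0_abs.
Qed.

Lemma Zh_nodes_neq0 c : Zh_nodes h c != 0 ->
  exists2 l, ZN lt a l & c = toQ l + cvec lt a.
Proof.
move=> Z; have [own ownP] := owner_exists G_tree G_nodes.
have : ~ forall x : {ffun G -> rat}, piN x = c -> Zh h x = 0.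
  by move=> H; move/eqP: Z; apply; apply: fsbig1 => x /= /H.
move/existsNP => [x /not_implyP[xc /eqP]].
move=> /(Zh_neq0 G_tree G_negdef)[xh [k [xk k2]]].
have /lat_classP xint := xh.
pose l : {ffun node G -> int} := [ffun n => Num.floor (x (val n) - lift_elt lt a (val n))].
have xn n : x (val n) = (l n)%:~R + cvec lt a n.
  by rewrite /l ffunE floorK ?xint // [cvec lt a n]ffunE subrK.
have [lZ _] := source_vec_surj G_tree G_negdef G_min G_nodes lt_order ownP xh xk k2 xn.
exists l => //; apply/ffunP => n; rewrite -xc [LHS]ffunE xn [RHS]ffunE.
by congr (_ + _); rewrite [RHS]ffunE.
Qed.

End NodeSeries.

(** * Expansions of fractions *)

Section TaylorFrac.
Variables (I : finType) (p : {ffun I -> rat}) (v : I -> {ffun I -> int}).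
Implicit Types (S : set {ffun I -> int}) (J : {set I}) (l : {ffun I -> int}).

Definition int_comb (k : I -> int) : {ffun I -> int} := [ffun i => \sum_n k n * v n i].

Lemma toQ_inj : injective (@toQ I).
Proof.
move=> l l' E; apply/ffunP => i; move/ffunP/(_ i): E; rewrite !ffunE.
exact: intr_inj.
Qed.

Lemma toQ_comb (k : {ffun I -> nat}) :
  \sum_i toQ (v i) *+ k i = toQ (int_comb (fun i => (k i)%:Z)).
Proof.
apply/ffunP => j; rewrite sum_ffunE !ffunE rmorph_sum /=; apply: eq_bigr => i _.
rewrite intrM mulrC -[(k i)%:~R]/((k i)%:R) mulr_natr.
by elim: (k i) => [|m IH]; rewrite ?mulr0n ?ffunE // !mulrS !ffunE IH.
Qed.

Lemma toQD l l' : toQ (l + l') = toQ l + toQ l'.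
Proof. by apply/ffunP => i; rewrite !ffunE intrD. Qed.

Lemma taylor_frac_neq0 S J c : taylor_frac S p J v c != 0 ->
  exists l, c = toQ l + p.
Proof.
move=> Z; apply: contrapT => no; move/eqP: Z; apply.
apply: fsbig1 => l Sl; apply: taylor_eq0 => x.
rewrite toQ_comb => E; case: no; exists (l + int_comb (fun i => (x i)%:Z)).
by rewrite toQD E -/(toQ l) addrC addrA -/(toQ l) addrCA subrr addr0.
Qed.

(** If l has a unique decomposition into a point of S and an integral combination
    of the v n, then a single term of the series contributes. *)
Lemma taylor_fracE S J l l0 (k : I -> int) :
  l = l0 + int_comb k ->
  (forall k' l0', S l0' -> l = l0' + int_comb k' -> l0' = l0 /\ k' =1 k) ->
  taylor_frac S p J v (toQ l + p) =
    (l0 \in S)%:R * \prod_n (if n \in J then (0 <= k n)%R%:R else (k n == 0)%:R).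
Proof.
move=> lE uniq_l.
have solve l' (x : {ffun I -> nat}) : S l' ->
    \sum_i toQ (v i) *+ x i = toQ l + p - (p + toQ l') ->
    l' = l0 /\ (fun i => (x i)%:Z) =1 k.
  move=> Sl' E; apply: uniq_l => //; apply: toQ_inj.
  by rewrite toQD -toQ_comb E addrKA addrC subrK.
rewrite /taylor_frac /=; have [/set_mem Sl0|nS] := boolP (l0 \in S); last first.
  rewrite mul0r; apply: fsbig1 => l' Sl'; apply: taylor_eq0 => x E.
  by have [l'0 _] := solve l' x Sl' E; move: nS; rewrite -l'0 mem_set.
rewrite mul1r -(@fsbig_widen _ _ _ _ [set l0]%classic); last first.
- move=> l' /= [Sl' ne]; apply: taylor_eq0 => x E.
  by have [l'0 _] := solve l' x Sl' E; case: ne.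
- by move=> l' /= ->.
rewrite fsbig_set1.
have [k0|] := boolP [forall n, 0 <= k n].
  have kE n : k n = (`|k n|%N)%:Z by rewrite gez0_abs ?(forallP k0).
  rewrite (@taylor_eq _ _ _ _ _ [ffun n => `|k n|%N]).
  - apply: eq_bigr => n _; rewrite ffunE (forallP k0 n).
    case: ifP => _; first by rewrite /= add0n binn.
    by rewrite [in RHS]kE eqz_nat /= bin0n; case: (`|k n|%N) => [|j]; rewrite ?mul1r // mulr0.
  - rewrite toQ_comb -/(toQ l0) addrKA lE toQD addrAC subrr add0r.
    by congr toQ; apply/ffunP => i; rewrite !ffunE; apply: eq_bigr => n _; rewrite ffunE [in RHS]kE.
  move=> x E; have [_ xk] := solve l0 x Sl0 E; apply/ffunP => n.
  by rewrite ffunE -xk.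
case/forallPn => n; rewrite -ltNge => kn.
rewrite [RHS](bigD1 n) //= leNgt kn /= (lt_eqF kn) if_same mul0r.
apply: taylor_eq0 => x E; have [_ xk] := solve l0 x Sl0 E.
by move: kn; rewrite -xk.
Qed.
End TaylorFrac.

(** * The orbifold cone and the translated boxes *)

Section OrbifoldCone.
Variable G : plumbing_graph.
Hypothesis G_tree : is_tree G.
Hypothesis G_negdef : negative_definite G.
Hypothesis G_min : minimal_good G.
Variable lt : rel (node G).
Hypothesis lt_order : orders_nbr_nodes lt.
Variable R : realType.
Implicit Types (u w : G) (n m : node G) (l : {ffun node G -> int}).

Lemma lap_ratr (z : G -> rat) u : lap (fun w => ratr (z w) : R) u = ratr (lap z u).
Proof.
rewrite /lap rmorphB rmorphM rmorphN /= ratr_int rmorph_sum /=.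
by [].
Qed.

Lemma Nlin_ratr (x : node G -> rat) n :
  Nlin (fun m => ratr (x m) : R) n = ratr (Nlin x n).
Proof.
rewrite /Nlin rmorphB rmorphM rmorphN !rmorphD !rmorph_sum /= ratr_int.
congr (- (_ + _ + _) * _ - _); apply: eq_bigr => m _;
  by rewrite rmorphM fmorphV /= ?ratr_int.
Qed.

Definition realE u w : R := ratr (Estar u w).

Lemma lap_realE u w : lap (realE u) w = (u == w)%:R.
Proof. by rewrite lap_ratr (lap_Estar G_tree G_negdef) ratr_nat. Qed.

(** From a point of the cone, moving all sources to the nodes without changing the
    node coordinates only increases those at the nodes. *)
Lemma CorbP (x : {ffun node G -> R}) : Corb x <-> forall n, 0 <= Nlin x n.
Proof.
split=> [[s sL <-] n|x0].
  have s0 u : 0 <= lap s u by have := sL u; rewrite (form_basisE G_tree) oppr_le0.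
  apply: (le_trans (s0 (val n))).
  have := Nlin_super G_tree G_min (z := s) n (fun v _ => s0 v).
  by congr (_ <= _); apply: eq_Nlin => m; rewrite ffunE.
exists [ffun u => node_comb realE (Nlin x) u].
  move=> u; rewrite (form_basisE G_tree) oppr_le0.
  rewrite (lap_eq (z' := node_comb realE (Nlin x))) => [|w]; last by rewrite ffunE.
  have [un|un] := boolP (u \in nodes G).
    by rewrite -[u]/(val (exist _ u un : node G)) (lap_node_comb_node lap_realE).
  by rewrite (lap_node_comb_nonnode lap_realE).
apply/ffunP => n; rewrite !ffunE.
exact: (node_comb_Nlin G_tree G_min lap_realE).
Qed.

Variable v : node G -> {ffun node G -> int}.
Hypothesis v_cone : cone v = @Corb G R.

(** Every point is a difference of two points of the cone: split its coordinates
    Nlin x n into positive and negative parts. *)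
Lemma lincomb_surj (x : node G -> R) : exists s, lincomb v s =1 x.
Proof.
have in_cone (d : node G -> R) : (forall n, 0 <= d n) ->
    exists s, lincomb v s =1 fun n => node_comb realE d (val n).
  move=> d0; have : @cone G R v [ffun n => node_comb realE d (val n)].
    rewrite v_cone; apply/CorbP => n.
    rewrite (eq_Nlin (y := fun m => node_comb realE d (val m))) => [|m]; last by rewrite ffunE.
    by rewrite (Nlin_node_comb G_tree G_min lap_realE).
  by case=> s _ /ffunP E; exists s => n; rewrite -E ffunE.
have max0 (c : R) : 0 <= Num.max c 0 by rewrite le_max lexx orbT.
have [s1 s1P] := in_cone (fun n => Num.max (Nlin x n) 0) (fun n => max0 _).
have [s2 s2P] := in_cone (fun n => Num.max (- Nlin x n) 0) (fun n => max0 _).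
exists (fun n => s1 n - s2 n) => n.
rewrite -(node_comb_Nlin G_tree G_min lap_realE x n).
transitivity (lincomb v s1 n - lincomb v s2 n).
  by rewrite !ffunE -sumrB; apply: eq_bigr => m _; rewrite mulrBl.
rewrite s1P s2P /node_comb -sumrB; apply: eq_bigr => m _; rewrite -mulrBl.
congr (_ * _); rewrite !maxEle oppr_le0.
by case: (lerP (Nlin x m) 0) => H; case: (lerP 0 (Nlin x m)) => H'; lra.
Qed.

Lemma lincomb_inj (s s' : node G -> R) : lincomb v s = lincomb v s' -> s =1 s'.
Proof.
move=> /ffunP E n; apply/eqP; rewrite -subr_eq0; apply/eqP.
have surj x : exists s, forall m, \sum_n (v n m)%:~R * s n = x m :> R.
  have [s0 s0P] := lincomb_surj x; exists s0 => m; rewrite -s0P ffunE.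
  by apply: eq_bigr => j _; rewrite mulrC.
apply: (square_surj_inj surj (s := fun n => s n - s' n)) => m.
have := E m; rewrite !ffunE => /eqP; rewrite -subr_eq0 -sumrB => /eqP E0.
by rewrite -[RHS]E0; apply: eq_bigr => j _; ring.
Qed.

Lemma lincomb_int (k : node G -> int) i :
  lincomb v (fun n => (k n)%:~R : R) i = (int_comb v k i)%:~R.
Proof. by rewrite !ffunE rmorph_sum /=; apply: eq_bigr => n _; rewrite intrM. Qed.

Definition shifted (b : reduced_lift G) l : {ffun node G -> R} :=
  [ffun n => (l n)%:~R + ratr (cvec lt b n)].

Lemma shifted_ge0 b l : @cone G R v (shifted b l) <-> forall n, 0 <= Nbar lt b l n.
Proof.
rewrite v_cone CorbP.
have E n : Nlin (shifted b l) n = ratr (Nbar lt b l n).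
  rewrite (NbarE G_tree G_negdef G_min lt_order) -Nlin_ratr; apply: eq_Nlin => m.
  by rewrite ffunE rmorphD /= ratr_int.
by split=> H n; have := H n; rewrite E ler0q.
Qed.

(** The coefficients k n are the integer parts of the coordinates of l + c_b in the
    basis v. *)
Lemma box_decomposition b l : exists k l0,
  [/\ shifted_box lt R v b l0, l = l0 + int_comb v k,
      forall k' l0', shifted_box lt R v b l0' -> l = l0' + int_comb v k' ->
        l0' = l0 /\ k' =1 k &
      (forall n, 0 <= k n) <-> (forall n, 0 <= Nbar lt b l n)].
Proof.
have [s sP] := lincomb_surj (shifted b l).
have floor_uniq k' l0' : shifted_box lt R v b l0' -> l = l0' + int_comb v k' ->
    k' =1 fun n => Num.floor (s n).
  move=> [s' s'01 s'P] lE n.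
  have : s =1 fun n => s' n + (k' n)%:~R.
    apply: lincomb_inj; apply/ffunP => i; rewrite sP.
    transitivity (lincomb v s' i + lincomb v (fun n => (k' n)%:~R : R) i).
      have li : l i = l0' i + int_comb v k' i by rewrite lE ffunE.
      by rewrite lincomb_int -s'P [LHS]ffunE [X in _ = X + _]ffunE li intrD addrAC.
    by rewrite !ffunE -big_split; apply: eq_bigr => j _; rewrite mulrDl.
  move=> ->; have /andP[s0 s1] := s'01 n.
  rewrite floorDrz ?intr_int // intrKfloor (floor_def (m := 0)) ?add0r //.
pose k n := Num.floor (s n); pose l0 := l - int_comb v k.
have l0_box : shifted_box lt R v b l0.
  exists (fun n => s n - (k n)%:~R).
    move=> n; rewrite subr_ge0 floor_le /= ltrBlDl -[X in _ < _ + X]/(1%:~R) -intrD.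
    exact: floorD1_gt.
  apply/ffunP => i.
  transitivity (lincomb v s i - lincomb v (fun n => (k n)%:~R : R) i).
    have li : l0 i = l i - int_comb v k i by rewrite /l0 !ffunE.
    by rewrite lincomb_int sP [LHS]ffunE [X in _ = X - _]ffunE li intrB addrAC.
  by rewrite !ffunE -sumrB; apply: eq_bigr => j _; rewrite mulrBl.
exists k, l0; split=> //; first by rewrite subrK.
- move=> k' l0' box' lE; have kk := floor_uniq k' l0' box' lE; split=> //.
  have -> : l0' = l - int_comb v k' by rewrite lE addrK.
  by congr (_ - _); apply/ffunP => i; rewrite !ffunE; apply: eq_bigr => n _; rewrite kk.
- rewrite -shifted_ge0; split=> [k0|[s' s'0 sE] n].
    exists s; last by apply/ffunP => i; rewrite sP.
    by move=> n; rewrite -floor_ge0; exact: k0.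
  rewrite /k floor_ge0 (lincomb_inj (s' := s')) // -sE.
  by apply/ffunP => i; rewrite sP.
Qed.

End OrbifoldCone.

(** * Inclusion-exclusion over the holes *)

Section InclusionExclusion.
Variable G : plumbing_graph.
Hypothesis G_tree : is_tree G.
Hypothesis G_negdef : negative_definite G.
Hypothesis G_min : minimal_good G.
Variable lt : rel (node G).
Hypothesis lt_order : orders_nbr_nodes lt.
Variable R : realType.
Variable v : node G -> {ffun node G -> int}.
Implicit Types (n m : node G) (l : {ffun node G -> int}) (I H : {set node G}).
Variables (b : reduced_lift G) (kappa : nat).
Hypothesis b_adm : admissible lt R v b kappa.

Let v_cone : cone v = @Corb G R. Proof. by case: b_adm. Qed.

Lemma ZN_add l k : ZN lt b (l + int_comb v k) <-> ZN lt b l.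
Proof.
have comb0 n m : m \in nbr_nodes n -> lt n m ->
    (alpha n m %| int_comb v k n + omega m n * int_comb v k m)%Z.
  move=> nm ltnm; rewrite !ffunE mulr_sumr -big_split /=.
  apply: (big_ind (fun x => (alpha n m %| x)%Z)) => [|x y|j _].
  - exact: dvdz0.
  - exact: rpredD.
  have [vM _ _] := b_adm; have [vZ _] := vM j.
  have /eqP := vZ n m nm ltnm; rewrite eqz_mod_dvd subr0 => dv.
  by rewrite mulrCA -mulrDr dvdz_mull.
split=> H n m nm ltnm; have /eqP := H n m nm ltnm; rewrite eqz_mod_dvd => Hd;
  apply/eqP; rewrite eqz_mod_dvd; move: Hd; have := comb0 n m nm ltnm.
- move=> d1 d2; have := rpredB d2 d1; congr (_ %| _)%Z.
  by rewrite !ffunE; ring.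
- move=> d1 d2; have := rpredD d2 d1; congr (_ %| _)%Z.
  by rewrite !ffunE; ring.
Qed.

Lemma Mbar_add l k : Mbar lt b l -> (forall n, 0 <= k n) -> Mbar lt b (l + int_comb v k).
Proof.
move=> [lZ lN] k0; split; first by apply/ZN_add.
apply/(shifted_ge0 G_tree G_negdef G_min lt_order v_cone).
have [s s0 sE] := (shifted_ge0 G_tree G_negdef G_min lt_order v_cone b l).2 lN.
exists (fun n => s n + (k n)%:~R) => [n|]; first by rewrite addr_ge0 ?ler0z.
apply/ffunP => i.
transitivity (lincomb v s i + lincomb v (fun n => (k n)%:~R : R) i).
  have li : (l + int_comb v k) i = l i + int_comb v k i by rewrite ffunE.
  by rewrite lincomb_int -sE [LHS]ffunE [X in _ = X + _]ffunE li intrD addrAC.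
by rewrite !ffunE -big_split; apply: eq_bigr => j _; rewrite mulrDl.
Qed.

Lemma int_comb_step (k : node G -> nat) j : (0 < k j)%N ->
  int_comb v (fun n => (k n)%:Z) =
  int_comb v (fun n => (k n - (n == j))%N%:Z) + v j.
Proof.
move=> kj; apply/ffunP => i; rewrite !ffunE.
rewrite (bigD1 j) //= [X in _ = X + _](bigD1 j) //= eqxx.
rewrite (eq_bigr (fun n => (k n - (n == j))%N%:Z * v n i)) => [|n /negPf->]; last by rewrite subn0.
by case: (k j) kj => // kj' _; rewrite subn1 /= -addn1 PoszD; ring.
Qed.

Lemma Na_shift0 l (k : node G -> nat) n : Mbar lt b l -> k n = 0%N ->
  Na lt b (l + int_comb v (fun j => (k j)%:Z)) n = Na lt b l n.
Proof.
move=> lM; have [d] := ubnP (\sum_j k j)%N; elim: d k => // d IH k led kn.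
have [/existsP[j kj]|] := boolP [exists j, (0 < k j)%N]; last first.
  move/existsPn => k0; congr (Na _ _ _ _); apply/ffunP => i.
  rewrite !ffunE big1 ?addr0 // => j _; have := k0 j.
  by rewrite -eqn0Ngt => /eqP ->; rewrite mul0r.
have nj : n != j by apply: contraTneq kj => <-; rewrite kn.
rewrite (int_comb_step kj) addrA.
have [_ _ adm] := b_adm.
have [NaE _] := adm _ (Mbar_add lM (k := fun n => (k n - (n == j))%N%:Z) (fun n => isT)) j.
rewrite NaE //.
apply: IH; last by rewrite kn.
move: led; rewrite !(bigD1 (P := xpredT) j) //= eqxx subn1.
rewrite [X in (_.-1 + X)%N](eq_bigr k) => [|i /negPf->]; last by rewrite subn0.
by case: (k j) kj.
Qed.

Lemma Na_shift l (k : node G -> nat) n : Mbar lt b l -> (0 < k n)%N ->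
  kappa%:R <= Na lt b (l + int_comb v (fun j => (k j)%:Z)) n.
Proof.
move=> lM kn; rewrite (int_comb_step kn) addrA.
have [_ _ adm] := b_adm.
by have [] := adm _ (Mbar_add lM (k := fun m => (k m - (m == n))%N%:Z) (fun n => isT)) n.
Qed.

(** Both kinds of sets of holes in the theorem are of this form: H is empty in the
    first formula, and the set of nodes with at least two neighbouring nodes in the
    second one. *)
Definition holes H I : set {ffun node G -> int} :=
  [set l | [/\ shifted_box lt R v b l, ZN lt b l,
              forall n, n \in I :\: H -> Na lt b l n < 0 &
              forall n, n \in H -> Na lt b l n = 0]]%classic.

(** The generating function of the l with N_b(l, n) = 0 on H and N_b(l, n) >= 0
    elsewhere.  Write l = l0 + sum_n k n v n.  If all k n >= 0, the node n outside H
    satisfies N_b(l, n) < 0 iff k n = 0 and N_b(l0, n) < 0, and a node n of H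
    satisfies N_b(l, n) = 0 iff k n = 0 and N_b(l0, n) = 0; if some k n is negative
    then both sides vanish. *)
Lemma holes_series H (p : {ffun node G -> rat}) l :
  (forall n, n \in H -> (0 < kappa)%N) ->
  \sum_(I : {set node G} | H \subset I)
     (-1) ^+ #|I :\: H| * taylor_frac (holes H I) p (~: I) v (toQ l + p) =
  (l \in ZN lt b)%:R *
    \prod_n (if n \in H then (Na lt b l n == 0) else (0 <= Na lt b l n)%R)%:R.
Proof.
move=> Hkappa.
have [k [l0 [l0box lE uniq_l k0]]] :=
  box_decomposition G_tree G_negdef G_min lt_order v_cone b l.
(* The sum over I is expanded as a product over the nodes of F n + K n, where F n
   collects the case n in I and K n the case n not in I. *)
pose cond n := if n \in H then Na lt b l0 n == 0 else Na lt b l0 n < 0.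
pose F n : int := (if n \in H then 1 else -1) * ((k n == 0)%:R * (cond n)%:R).
pose K n : int := if n \in H then 0 else (0 <= k n)%R%:R.
have ZE : (l \in ZN lt b) = (l0 \in ZN lt b).
  by rewrite lE; apply/idP/idP => /set_mem/ZN_add/mem_set.
have termE I : H \subset I ->
    (-1) ^+ #|I :\: H| * taylor_frac (holes H I) p (~: I) v (toQ l + p) =
    (l \in ZN lt b)%:R * \prod_n (if n \in I then F n else K n).
  move=> HI; rewrite (@taylor_fracE _ p v (holes H I) (~: I) l l0 k lE); last first.
    by move=> k' l0' [box' _ _ _]; exact: uniq_l.
  have -> : (l0 \in holes H I) = (l0 \in ZN lt b) && [forall n, (n \in I) ==> cond n].
    apply/idP/andP => [/set_mem[_ lZ neg eq0]|[/set_mem lZ /forallP c0]].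
      split; first exact: mem_set.
      apply/forallP => n; apply/implyP => nI; rewrite /cond.
      by case: ifP => nH; [rewrite eq0 | apply: neg; rewrite inE nH nI].
    apply/mem_set; split=> // n; have := c0 n; rewrite /cond.
      by rewrite inE => /implyP H1 /andP[/negPf nH /H1]; rewrite nH.
    by move=> + nH; rewrite nH (fintype.subsetP HI _ nH) => /eqP.
  have -> : ((l0 \in ZN lt b) && [forall n, (n \in I) ==> cond n])%:R =
      (l \in ZN lt b)%:R * \prod_(n in I) (cond n)%:R :> int.
    rewrite ZE -mulnb natrM; congr (_ * _).
    have [/forallP c0|/forallPn[n]] := boolP [forall n, (n \in I) ==> cond n].
      by rewrite big1 // => n nI; have := c0 n; rewrite nI /= => ->.
    by rewrite negb_imply => /andP[nI /negPf cn]; rewrite (bigD1 n) //= cn mul0r.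
  rewrite -prodr_const mulrCA -!mulrA; congr (_ * _).
  rewrite big_mkcond [X in _ * (X * _)]big_mkcond -!big_split /=.
  apply: eq_bigr => n _; rewrite /F /K !inE.
  have [nI|nI] := boolP (n \in I); have [nH|nH] := boolP (n \in H) => //=.
  - ring.
  - ring.
  - by have := fintype.subsetP HI n nH; rewrite (negPf nI).
  - by rewrite !mul1r.
rewrite (eq_bigr _ termE) -mulr_sumr.
have [lZ|] := boolP (l \in ZN lt b); last by rewrite !mul0r.
congr (_ * _).
transitivity (\prod_n (F n + K n)).
  rewrite bigA_distr /= [LHS]big_mkcond; apply: eq_bigr => I _.
  case: ifP => // /negbT/fintype.subsetPn[n nH nI].
  by rewrite (bigD1 n) //= (negPf nI) /K nH mul0r.
have {}lZ : ZN lt b l by apply: set_mem.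
have l0Z : ZN lt b l0 by move: lZ; rewrite lE ZN_add.
have [kpos|] := boolP [forall n, 0 <= k n].
  have l0M : Mbar lt b l0.
    split=> //; have [k' [l0' [box' lE' uniq' k0']]] :=
      box_decomposition G_tree G_negdef G_min lt_order v_cone b l0.
    apply/k0' => n; have [|_ <-] := uniq' (fun=> 0) l0 l0box _; last by [].
    by apply/ffunP => i; rewrite !ffunE big1 ?addr0 // => j _; rewrite mul0r.
  have kE n : k n = (`|k n|%N)%:Z by rewrite gez0_abs ?(forallP kpos).
  have {}lE : l = l0 + int_comb v (fun n => (`|k n|%N)%:Z).
    rewrite lE; congr (_ + _); apply/ffunP => i; rewrite !ffunE.
    by apply: eq_bigr => n _; rewrite [in LHS]kE.
  apply: eq_bigr => n _; rewrite /F /K /cond (forallP kpos n).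
  have [kn|kn] := eqVneq (k n) 0.
    rewrite lE Na_shift0 ?kn //; case: ifP => _; first by rewrite !mul1r addr0.
    by rewrite leNgt mul1r mulN1r; case: (_ < 0).
  have := @Na_shift l0 (fun j => `|k j|%N) n l0M; rewrite absz_gt0 -lE => /(_ kn) ge.
  case: ifP => nH; rewrite mul0r mulr0 add0r; last first.
    by rewrite (le_trans _ ge) // ler0n.
  suff : Na lt b l n != 0 by move/negPf->.
  by rewrite gt_eqF // (lt_le_trans _ ge) // ltr0n (Hkappa n).
case/forallPn => n; rewrite -ltNge => kn.
rewrite (bigD1 n) //= /F /K (lt_eqF kn) mul0r mulr0 add0r leNgt kn if_same mul0r.
have : ~ forall m, 0 <= Na lt b l m.
  move=> N0; have := k0.2 _ n; rewrite leNgt kn => /(_ _)/negP; apply => // m.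
  rewrite /Nbar addr_ge0 // sumr_ge0 // => u _; rewrite subr_ge0; exact: floor_le.
move/existsNP => [m /negP]; rewrite -ltNge => Nm.
rewrite [RHS](bigD1 m) //= (lt_eqF Nm) leNgt Nm if_same mul0r.
by [].
Qed.

End InclusionExclusion.

(** * Summation over k *)

(** The product of (1 - X)^d and 1 / (1 - X). *)
Lemma sum_binomial_le (d B : nat) (x : int) : (x <= B%:Z)%R ->
  \sum_(k < d.+1) ((-1) ^+ k * 'C(d, k)%:Z) * (k%:Z <= x)%R%:R = zbinom (d%:Z - 1) x.
Proof.
move=> xB; rewrite -(sum_zbinom1 d xB).
under [RHS]eq_bigr do rewrite zbinomS.
rewrite exchange_big; apply: eq_bigr => k _; rewrite -mulr_sumr; congr (_ * _).
have [kx|xk] := lerP k%:Z x.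
  have jB : (`|(x - k%:Z)%R|%N < B.+1)%N by rewrite ltnS; lia.
  rewrite (bigD1 (Ordinal jB)) //= big1 => [|j nj].
    by rewrite addr0 (_ : (x - _ == _) = true) //; apply/eqP; lia.
  rewrite (_ : (x - _ == _) = false) //; apply/eqP => E.
  by move/eqP: nj; apply; apply: val_inj => /=; lia.
rewrite big1 // => j _; rewrite (_ : (x - _ == _) = false) //.
by apply/eqP; lia.
Qed.

Section KSum.
Variable G : plumbing_graph.
Implicit Types (n : node G).

Lemma sum_krange (i : nat) (g : node G -> nat -> int) :
  \sum_(k \in krange G i) \prod_n g n (k n) =
  \prod_n (if n \in hatN G then \sum_(j < (deltaN n - i).+1) g n j else g n 0%N).
Proof.
pose D := (\sum_(n : node G) deltaN n)%N.
have leD n : (deltaN n - i <= D)%N.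
  by rewrite (leq_trans (leq_subr _ _)) // /D (bigD1 n) //= leq_addr.
pose rng n (j : nat) := if n \in hatN G then (j <= deltaN n - i)%N else j == 0%N.
pose emb (f : {ffun node G -> 'I_D.+1}) : {ffun node G -> nat} := [ffun n => f n : nat].
have emb_inj : injective emb.
  move=> f f' /ffunP E; apply/ffunP => n; apply: val_inj.
  by have := E n; rewrite !ffunE.
pose K := [pred f : {ffun node G -> 'I_D.+1} | [forall n, rng n (f n)]].
rewrite (@fsbigE _ _ _ _ _ [seq emb f | f <- enum K]).
- rewrite big_map big_enum_cond /=.
  rewrite (eq_bigl (mem K)) => [|f]; last first.
    rewrite andb_idr // => /forallP fK; apply/mem_set => n.
    by have := fK n; rewrite /rng ffunE.
  transitivity (\sum_(f : {ffun node G -> 'I_D.+1})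
      \prod_n (if rng n (f n) then g n (f n) else 0)).
    rewrite big_mkcond; apply: eq_bigr => f _; case: ifPn => [/forallP fK|].
      by apply: eq_bigr => n _; rewrite fK ffunE.
    by case/forallPn => n /negPf fn; rewrite (bigD1 n) //= fn mul0r.
  rewrite -(bigA_distr_bigA (fun n (j : 'I_D.+1) => if rng n j then g n j else 0)) /=.
  apply: eq_bigr => n _; rewrite -big_mkcond /rng; case: ifP => _.
    by rewrite (big_ord_widen D.+1 (g n)) ?ltnS.
  by rewrite (big_pred1 ord0) // => j; rewrite -val_eqE.
- by rewrite map_inj_uniq ?enum_uniq.
- move=> k /= /mapP[f]; rewrite mem_enum => /forallP fK -> n.
  by have := fK n; rewrite /rng ffunE.
move=> k /= kr /mapP[].
have kD n : (k n < D.+1)%N.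
  rewrite ltnS; have := kr n; case: ifP => _ kn; last by rewrite (eqP kn).
  exact: leq_trans kn (leD n).
exists [ffun n => inord (k n)].
  by rewrite mem_enum; apply/forallP => n; rewrite /rng ffunE inordK //; exact: kr.
by apply/ffunP => n; rewrite !ffunE inordK.
Qed.

End KSum.

Section Main.
Variable G : plumbing_graph.
Hypothesis G_tree : is_tree G.
Hypothesis G_negdef : negative_definite G.
Hypothesis G_min : minimal_good G.
Hypothesis G_nodes : nodes G != finset.set0.
Hypothesis deltaN_ge1 : forall n : node G, (1 <= deltaN n)%N.
Variable lt : rel (node G).
Hypothesis lt_order : orders_nbr_nodes lt.
Variable R : realType.
Variable a : reduced_lift G.
Variable v : node G -> {ffun node G -> int}.
Implicit Types (n : node G) (k : {ffun node G -> nat}) (l : {ffun node G -> int}).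

Lemma Na_sub k l n : Na lt (lift_sub a k) l n = Na lt a l n - (k n)%:R.
Proof. by rewrite /Na /= intrB -[(k n)%:Z%:~R]/((k n)%:R); ring. Qed.

Lemma deltaN_nonhat n : n \notin hatN G -> deltaN n = 1%N.
Proof.
by rewrite inE -leqNgt => d1; apply/eqP; rewrite eqn_leq d1 deltaN_ge1.
Qed.

(** On both sides only the exponents c_a + l with l integral occur, so it suffices to
    compare these coefficients with the ones found in Zh_nodes_ZN. *)
Lemma node_series_eq (K : set {ffun node G -> nat}) (T : finType) (P : pred T)
    (coef : {ffun node G -> nat} -> int) (sg : T -> int)
    (S : {ffun node G -> nat} -> T -> set {ffun node G -> int}) (J : T -> {set node G}) c :
  (forall l, \sum_(k \in K) coef k * \sum_(t | P t)
      sg t * taylor_frac (S k t) (cvec lt a) (J t) v (toQ l + cvec lt a) =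
    (l \in ZN lt a)%:R * \prod_n zbinom ((deltaN n)%:Z - 2) (Num.floor (Na lt a l n))) ->
  Zh_nodes (lat_class (lift_elt lt a)) c =
  \sum_(k \in K) coef k * \sum_(t | P t)
      sg t * taylor_frac (S k t) (cvec lt a) (J t) v c.
Proof.
move=> E; have [[l ->]|no] := EM (exists l, c = toQ l + cvec lt a).
  rewrite E; have [/set_mem lZ|lZ] := boolP (l \in ZN lt a).
    by rewrite mul1r Zh_nodes_ZN.
  rewrite mul0r; apply/eqP; apply: contraNT lZ.
  move=> /(Zh_nodes_neq0 G_tree G_negdef G_min G_nodes lt_order)[l' lZ].
  by move=> /addIr/toQ_inj ->; apply/mem_set.
rewrite fsbig1 => [|k _].
  apply/eqP; apply: contra_notT no.
  by move=> /(Zh_nodes_neq0 G_tree G_negdef G_min G_nodes lt_order)[l _ ->]; exists l.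
rewrite big1 ?mulr0 // => t _.
suff -> : taylor_frac (S k t) (cvec lt a) (J t) v c = 0 by rewrite mulr0.
apply/eqP; apply: contra_notT no; exact: taylor_frac_neq0.
Qed.

Lemma node_series_kappa0 :
  (forall k, krange G 1 k -> admissible lt R v (lift_sub a k) 0) ->
  forall c : {ffun node G -> rat},
    Zh_nodes (lat_class (lift_elt lt a)) c =
    \sum_(k \in krange G 1) kcoef 1 k * \sum_(I : {set node G})
      (-1) ^+ #|I| *
      taylor_frac (Mminus lt R v (lift_sub a k) I) (cvec lt a) (~: I) v c.
Proof.
move=> adm c; apply: node_series_eq => l.
pose g n (j : nat) : int :=
  (if n \in hatN G then (-1) ^+ j * 'C(deltaN n - 1, j)%:Z else 1) *
  (j%:R <= Na lt a l n)%R%:R.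
have termE k : krange G 1 k ->
    kcoef 1 k * (\sum_(I : {set node G}) (-1) ^+ #|I| *
      taylor_frac (Mminus lt R v (lift_sub a k) I) (cvec lt a) (~: I) v
        (toQ l + cvec lt a)) = (l \in ZN lt a)%:R * \prod_n g n (k n).
  move=> kr.
  have noH n : n \in (finset.set0 : {set node G}) -> (0 < 0)%N by rewrite inE.
  have := holes_series G_tree G_negdef G_min lt_order (adm k kr) (cvec lt a) l noH.
  rewrite (eq_bigl (fun I : {set node G} => true)) => [|I]; last by rewrite finset.sub0set.
  rewrite (eq_bigr (fun I : {set node G} => (-1) ^+ #|I| *
      taylor_frac (Mminus lt R v (lift_sub a k) I) (cvec lt a) (~: I) v
        (toQ l + cvec lt a))) => [->|I _]; last first.
    rewrite finset.setD0; congr (_ * taylor_frac _ _ _ _ _); apply/seteqP.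
    split=> x /= [xb xZ xI].
      by move=> _; split=> // n nI; apply: xI; rewrite finset.setD0.
    by split=> // n; [rewrite finset.setD0; exact: xI | rewrite inE].
  rewrite mulrCA; congr (_ * _); rewrite /kcoef big_mkcond -big_split /=.
  by apply: eq_bigr => n _; rewrite finset.in_set0 Na_sub subr_ge0 /g.
have [lZ|lZ] := boolP (l \in ZN lt a); last first.
  rewrite mul0r; apply: fsbig1 => k kr.
  by rewrite termE // (negPf lZ) mul0r.
rewrite mul1r; transitivity (\sum_(k \in krange G 1) \prod_n g n (k n)).
  by apply: eq_fsbigr => k /set_mem kr; rewrite termE // lZ mul1r.
rewrite sum_krange; apply: eq_bigr => n _; case: ifPn => nh.
  have d2 : (1 < deltaN n)%N by move: nh; rewrite inE.
  rewrite (_ : (deltaN n)%:Z - 2 = (deltaN n - 1)%N%:Z - 1); last by lia.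
  rewrite -(@sum_binomial_le _ `|Num.floor (Na lt a l n)|%N) ?abszE ?ler_norm //.
  by apply: eq_bigr => j _; rewrite /g nh floor_ge_int.
rewrite deltaN_nonhat // (_ : 1%:Z - 2 = -1) // zbinomN1 floor_ge0 /g (negPf nh).
by rewrite mul1r.
Qed.

Lemma node_series_kappa1 :
  (forall k, krange G 2 k -> admissible lt R v (lift_sub a k) 1) ->
  forall c : {ffun node G -> rat},
    Zh_nodes (lat_class (lift_elt lt a)) c =
    \sum_(k \in krange G 2) kcoef 2 k *
      \sum_(I : {set node G} | hatN G \subset I)
        (-1) ^+ #|I :\: hatN G| *
        taylor_frac (grMminus lt R v a k I) (cvec lt a) (~: I) v c.
Proof.
move=> adm c; apply: node_series_eq => l.
pose g n (j : nat) : int :=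
  if n \in hatN G then ((-1) ^+ j * 'C(deltaN n - 2, j)%:Z) * (Na lt a l n == j%:R)%:R
  else (0 <= Na lt a l n)%R%:R.
have termE k : krange G 2 k ->
    kcoef 2 k * (\sum_(I : {set node G} | hatN G \subset I)
        (-1) ^+ #|I :\: hatN G| *
        taylor_frac (grMminus lt R v a k I) (cvec lt a) (~: I) v
        (toQ l + cvec lt a)) = (l \in ZN lt a)%:R * \prod_n g n (k n).
  move=> kr.
  have k0 n : n \notin hatN G -> k n = 0%N.
    by move=> nh; have := kr n; rewrite (negPf nh) => /eqP.
  have := holes_series G_tree G_negdef G_min lt_order (adm k kr) (H := hatN G)
    (cvec lt a) l (fun _ _ => isT).
  rewrite (eq_bigr (fun I : {set node G} => (-1) ^+ #|I :\: hatN G| *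
        taylor_frac (grMminus lt R v a k I) (cvec lt a) (~: I) v
        (toQ l + cvec lt a))) => [->|I _]; last first.
    congr (_ * taylor_frac _ _ _ _ _); apply/seteqP.
    split=> x /= [xb xZ xI xh]; split=> // n nI.
    - by have := xI n nI; rewrite Na_sub k0 ?subr0 //; move: nI; rewrite inE => /andP[].
    - by have /eqP := xh n nI; rewrite Na_sub subr_eq0 => /eqP.
    - by rewrite Na_sub k0 ?subr0 ?xI //; move: nI; rewrite inE => /andP[].
    - by rewrite Na_sub xh // subrr.
  rewrite mulrCA; congr (_ * _); rewrite /kcoef big_mkcond -big_split /=.
  apply: eq_bigr => n _; rewrite Na_sub subr_eq0 subr_ge0 /g.
  by case: ifPn => // nh; rewrite k0 // mul1r.
have [lZ|lZ] := boolP (l \in ZN lt a); last first.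
  rewrite mul0r; apply: fsbig1 => k kr.
  by rewrite termE // (negPf lZ) mul0r.
rewrite mul1r; transitivity (\sum_(k \in krange G 2) \prod_n g n (k n)).
  by apply: eq_fsbigr => k /set_mem kr; rewrite termE // lZ mul1r.
rewrite sum_krange; apply: eq_bigr => n _; rewrite /g; case: ifPn => nh.
  have d2 : (1 < deltaN n)%N by move: nh; rewrite inE.
  rewrite (_ : (deltaN n)%:Z - 2 = (deltaN n - 2)%N%:Z); last by lia.
  rewrite zbinomS; apply: eq_bigr => j _; rewrite nh; congr (_ * (nat_of_bool _)%:R).
  have lZ' : ZN lt a l by apply: set_mem.
  have [own ownP] := owner_exists G_tree G_nodes.
  have /intrP[i ->] := Na_int G_tree G_negdef G_min G_nodes lt_order ownP n lZ'.
  by rewrite intrKfloor -[j%:R]/(j%:Z%:~R) eqr_int.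
by rewrite (negPf nh) deltaN_nonhat // (_ : 1%:Z - 2 = -1) // zbinomN1 floor_ge0.
Qed.

End Main.

Theorem theorem5p0p1 (R : realType) (G : plumbing_graph)
  (G_tree : is_tree G) (G_negdef : negative_definite G)
  (G_min : minimal_good G) (G_nodes : nodes G != finset.set0)
  (deltaN_ge1 : forall n : node G, (1 <= deltaN n)%N)
  (lt : rel (node G)) (lt_order : orders_nbr_nodes lt)
  (h : lat_quot G) (hH : Hgroup G h)
  (a : reduced_lift G) (ha : lat_class (lift_elt lt a) = h) :
  (forall v : node G -> {ffun node G -> int},
     (forall k, krange G 1 k -> admissible lt R v (lift_sub a k) 0) ->
     forall c : {ffun node G -> rat},
       Zh_nodes h c =
       \sum_(k \in krange G 1)
         kcoef 1 k *
         \sum_(I : {set node G})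
           (-1) ^+ #|I| *
           taylor_frac (Mminus lt R v (lift_sub a k) I) (cvec lt a) (~: I) v c)
  /\
  (forall v : node G -> {ffun node G -> int},
     (forall k, krange G 2 k -> admissible lt R v (lift_sub a k) 1) ->
     forall c : {ffun node G -> rat},
       Zh_nodes h c =
       \sum_(k \in krange G 2)
         kcoef 2 k *
         \sum_(I : {set node G} | hatN G \subset I)
           (-1) ^+ #|I :\: hatN G| *
           taylor_frac (grMminus lt R v a k I) (cvec lt a) (~: I) v c).
Proof.
rewrite -ha; split=> v adm c; first exact: node_series_kappa0.
exact: node_series_kappa1.
Qed.
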